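(* Let $(R, \mathfrak{m})$ be a Noetherian local ring and $M$ a finitely generated $R$-module of dimension $d > 0$. Then: \begin{enumerate} \item[(1)] $\mathfrak{b}(M)^{2^{s-1}} \subseteq \mathfrak{c}_s(M)$ for all $s = 1, \ldots, d-1$, and $\mathfrak{b}(M) \subseteq \mathfrak{c}_0(M)$. \item[(2)] $\mathfrak{b}(M)^{2^{s-1}-1} \subseteq \mathfrak{d}_s(M)$ for all $s = 1, \ldots, d$. \end{enumerate} In particular, for all systems of parameters $x_1, \ldots, x_d$ of $M$ and for all $n \ge 1$ we have $$\mathfrak{a}(M)^{2^{d-2}}\big((x_1, \ldots, x_s)^n M : x_{s+1}\big) \subseteq (x_1, \ldots, x_s)^n M$$ for all $1 \le s \le d-1$, and $$\mathfrak{a}(M)^{2^{d-1}}\Big(\bigcap_{\alpha \in \Lambda_{s,n}} Q_s(\alpha) M\Big) \subseteq (x_1, \ldots, x_s)^n M$$ for all $1 \le s \le d$.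
   Context: For a submodule $N \subseteq M$ and $x \in R$, $N : x = \{m \in M \mid xm \in N\}$; $I^0 = R$ for an ideal $I$. For $i < d$, $\mathfrak{a}_i(M) = \mathrm{Ann}\, H^i_{\mathfrak{m}}(M)$ (local cohomology), and $\mathfrak{a}(M) = \mathfrak{a}_0(M) \cdots \mathfrak{a}_{d-1}(M)$. For a system of parameters $\underline{x} = x_1, \ldots, x_d$ of $M$ and $0 \le s \le d$, $Q_s = (x_1, \ldots, x_s)$, with $Q_0 = (0)$. For $s, n \ge 1$, $$\Lambda_{s,n} = \{(\alpha_1, \ldots, \alpha_s) \in \mathbb{N}^s \mid \alpha_i \ge 1 \text{ for all } 1 \le i \le s,\ \sum_{i=1}^s \alpha_i = s+n-1\},$$ and for $\alpha \in \Lambda_{s,n}$ with $s \le d$, $Q_s(\alpha) = (x_1^{\alpha_1}, \ldots, x_s^{\alpha_s})$. One has $Q_s^n M \subseteq \bigcap_{\alpha \in \Lambda_{s,n}} Q_s(\alpha) M$. For $0 \le s < d$ set $$\mathfrak{b}_s(M) = \bigcap_{\underline{x}} \mathrm{Ann}\Big(\frac{Q_s M : x_{s+1}}{Q_s M}\Big), \qquad \mathfrak{c}_s(M) = \bigcap_{\underline{x},\, n \ge 1} \mathrm{Ann}\Big(\frac{Q_s^n M : x_{s+1}}{Q_s^n M}\Big),$$ and $\mathfrak{b}(M) = \mathfrak{b}_0(M) \cap \cdots \cap \mathfrak{b}_{d-1}(M)$. For $1 \le s \le d$ set $$\mathfrak{d}_s(M) = \bigcap_{\underline{x},\, n \ge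 1} \mathrm{Ann}\Big(\frac{\bigcap_{\alpha \in \Lambda_{s,n}} Q_s(\alpha) M}{Q_s^n M}\Big).$$ In all these intersections $\underline{x} = x_1, \ldots, x_d$ runs over all systems of parameters of $M$. *)

(* Defs.v *)
From HB Require Import structures.
From mathcomp Require Import all_boot all_order all_algebra.
From mathcomp Require Import boolp classical_sets.

Set Implicit Arguments.
Unset Strict Implicit.
Unset Printing Implicit Defensive.

Import GRing.Theory.

Local Open Scope classical_set_scope.
Local Open Scope ring_scope.

(* Ideals of R are the submodules of the regular module R^o; as R^o is
   convertible to R, an ideal is given as a term of type set R. *)

Section Submodules.
Variables (R : comNzRingType) (V : lmodType R).

Definition is_submodule (N : set V) : Prop :=
  N 0 /\ forall (a : R) (u v : V), N u -> N v -> N (a *: u + v).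

Definition span (S : set V) : set V := smallest is_submodule S.

Definition fin_gen (N : set V) : Prop := exists s : seq V, N = span [set` s].

Definition ideal_scale (I : set R) (N : set V) : set V :=
  span [set a *: u | a in I & u in N].

Definition colon (N : set V) (x : R) : set V := [set u | N (x *: u)].

(* For submodules B `<=` A this is Ann (A / B), the quotient not being formed. *)
Definition ann_quot (A B : set V) : set R :=
  [set r | forall u : V, A u -> B (r *: u)].

Definition ann_mod : set R := ann_quot setT [set 0].

(* A chain p_0 < ... < p_l of members of C has length l. *)
Definition has_chain (C : set (set V)) (l : nat) : Prop :=
  exists p : 'I_l.+1 -> set V,
    (forall i, C (p i)) /\ (forall i j : 'I_l.+1, (i < j)%N -> p i `<` p j).

(* V / N has finite length: bounded chains of submodules between N and V. *)
Definition finite_colength (N : set V) : Prop :=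
  exists b : nat, forall l : nat,
    has_chain [set L | is_submodule L /\ N `<=` L] l -> (l <= b)%N.

End Submodules.

Section Ideals.
Variable R : comNzRingType.

Definition is_ideal (I : set R) : Prop := is_submodule (V := R^o) I.

Definition ideal_gen (S : set R) : set R := span (V := R^o) S.

Definition ideal_mul (I J : set R) : set R := ideal_scale (V := R^o) I J.

Definition ideal_pow (I : set R) (n : nat) : set R := iter n (ideal_mul I) setT.

Definition prime_ideal (P : set R) : Prop :=
  [/\ is_ideal P, ~ P 1 & forall a b : R, P (a * b) -> P a \/ P b].

Definition maximal_ideal (P : set R) : Prop :=
  [/\ is_ideal P, ~ P 1 &
      forall I : set R, is_ideal I -> ~ I 1 -> P `<=` I -> I = P].

Definition local_ring (m : set R) : Prop :=
  maximal_ideal m /\ forall P : set R, maximal_ideal P -> P = m.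

Definition noetherian_ring : Prop :=
  forall I : set R, is_ideal I -> fin_gen (V := R^o) I.

End Ideals.

(* dim M = d, where dim M is the Krull dimension of R / Ann M. *)
Definition module_dim (R : comNzRingType) (M : lmodType R) (d : nat) : Prop :=
  let primes : set (set R^o) :=
    [set P | prime_ideal (P : set R) /\ ann_mod M `<=` P] in
  has_chain primes d /\ forall l : nat, has_chain primes l -> (l <= d)%N.

(* Tuples are indexed from 0: the i-th parameter x_i of the text is x`_(i-1). *)
Section SystemsOfParams.
Variables (R : comNzRingType) (d : nat).
Implicit Type x : d.-tuple R.

(* Q_s = (x_1, ..., x_s) *)
Definition Qs x (s : nat) : set R := ideal_gen (range (fun i : 'I_s => x`_i)).

(* Q_s(alpha) = (x_1^alpha_1, ..., x_s^alpha_s) *)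
Definition Qs_alpha x (s : nat) (alpha : 'I_s -> nat) : set R :=
  ideal_gen (range (fun i : 'I_s => x`_i ^+ alpha i)).

Definition Lambda (s n : nat) : set ('I_s -> nat) :=
  [set alpha | (forall i, (1 <= alpha i)%N) /\
               (\sum_(i < s) alpha i = s + n - 1)%N].

(* A system of parameters of M when dim M = d and m is the maximal ideal. *)
Definition sop (m : set R) (M : lmodType R) : set (d.-tuple R) :=
  [set x : d.-tuple R | (forall i : 'I_d, m x`_i) /\
           finite_colength (ideal_scale (Qs x d) [set: M])].

End SystemsOfParams.

(* Q_s^n M *)
Definition QsnM (R : comNzRingType) (M : lmodType R) (d : nat) (x : d.-tuple R)
    (s n : nat) : set M :=
  ideal_scale (ideal_pow (Qs x s) n) [set: M].

(* \bigcap_(alpha in Lambda_(s,n)) Q_s(alpha) M *)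
Definition bigcap_QalphaM (R : comNzRingType) (M : lmodType R) (d : nat)
    (x : d.-tuple R) (s n : nat) : set M :=
  \bigcap_(alpha in @Lambda s n) ideal_scale (Qs_alpha x alpha) [set: M].

Arguments QsnM {R} M {d} x s n.
Arguments bigcap_QalphaM {R} M {d} x s n.

Section LocalCohomology.
Variable R : comNzRingType.

Definition injective_module (E : lmodType R) : Prop :=
  forall (A B : lmodType R) (f : {linear A -> B}) (g : {linear A -> E}),
    injective f -> exists h : {linear B -> E}, forall u : A, h (f u) = g u.

Record injective_resolution (M : lmodType R) := InjectiveResolution {
  res_mod : nat -> lmodType R;
  res_aug : {linear M -> res_mod 0%N};
  res_diff : forall i : nat, {linear res_mod i -> res_mod i.+1};
  res_injective : forall i : nat, injective_module (res_mod i);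
  res_aug_inj : injective res_aug;
  res_exact0 : range res_aug = res_diff 0%N @^-1` [set 0];
  res_exactS : forall i : nat,
    range (res_diff i) = res_diff i.+1 @^-1` [set 0]
}.

(* The m-torsion functor Gamma_m. *)
Definition torsion (m : set R) (E : lmodType R) : set E :=
  [set e | exists n : nat, forall a : R, ideal_pow m n a -> a *: e = 0].

(* H^i_m(M) = cocycles / coboundaries of the complex Gamma_m(E). *)
Definition lc_cocycles (m : set R) (M : lmodType R)
    (E : injective_resolution M) (i : nat) : set (res_mod E i) :=
  torsion m (E := res_mod E i) `&` (res_diff E i @^-1` [set 0]).

Definition lc_coboundaries (m : set R) (M : lmodType R)
    (E : injective_resolution M) (i : nat) : set (res_mod E i) :=
  match i with
  | 0%N => [set 0]
  | j.+1 => res_diff E j @` torsion m (E := res_mod E j)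
  end.

Arguments lc_cocycles m {M} E i.
Arguments lc_coboundaries m {M} E i.

(* Ann H^i_m(M). The module H^i_m(M) does not depend on E up to isomorphism, so
   all the annihilators intersected here coincide; intersecting only avoids
   choosing a resolution. *)
Definition ai (m : set R) (M : lmodType R) (i : nat) : set R :=
  [set r | forall E : injective_resolution M,
     ann_quot (lc_cocycles m E i) (lc_coboundaries m E i) r].

Definition aM (m : set R) (M : lmodType R) (d : nat) : set R :=
  \big[@ideal_mul R/setT]_(i < d) ai m M i.

End LocalCohomology.

Section Annihilators.
Variables (R : comNzRingType) (m : set R) (M : lmodType R) (d : nat).

Definition bs (s : nat) : set R :=
  \bigcap_(x in @sop R d m M)
    ann_quot (colon (ideal_scale (Qs x s) [set: M]) x`_s)
             (ideal_scale (Qs x s) [set: M]).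

Definition bM : set R := \bigcap_(s in `I_d) bs s.

Definition cs (s : nat) : set R :=
  \bigcap_(x in @sop R d m M) \bigcap_(n in [set n : nat | (1 <= n)%N])
    ann_quot (colon (QsnM M x s n) x`_s) (QsnM M x s n).

Definition ds (s : nat) : set R :=
  \bigcap_(x in @sop R d m M) \bigcap_(n in [set n : nat | (1 <= n)%N])
    ann_quot (bigcap_QalphaM M x s n) (QsnM M x s n).

End Annihilators.

(* Main.v *)
From HB Require Import structures.
From mathcomp Require Import all_boot all_order all_algebra.
From mathcomp Require Import boolp classical_sets functions.
From mathcomp Require Import zify.
Require Import Defs.

(** Why the theorem is true.

    Write b for b(M).  A sequence obtained from a system of parameters by
    permuting it and raising its members to positive powers is again a system
    of parameters (finite_colengthP, sop_powers).  Hence, for every set T of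
    indices, all exponents e_i > 0 (i in T), every j outside T and every k > 0,
      b (N : x_j^k) is contained in N,   where N = sum_(i in T) x_i^e_i M
    (bM_colon).  Parts (1) and (2) are formal consequences of this property,
    once they are stated modulo such an N whose set T avoids 1, ..., s:
    - (1)_s follows from (2)_s, because Q_s^n M lies in each Q_s(alpha) M, so
      that one factor b moves an element of the colon into the intersection
      of the Q_s(alpha) M + N (colon_of_intersection);
    - (2)_(s+1) follows from (2)_s and (1)_s.  Put x = x_(s+1).  By (2)_s applied
      modulo x^k M + N, the ideal b^(2^(s-1) - 1) moves an element of the
      intersection to some v lying in Q_s^(n+1-k) M + x^k M + N for all k from 1
      to n.  Eliminating x^1, x^2, ... in turn gives, modulo N,
        v = q + x t_1 + ... + x^(n-1) t_(n-1) + x^n w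
      with q in Q_s^n M and x^k t_k in Q_s^(n-k) M + N, and (1)_s puts every
      b^(2^(s-1)) x^k t_k into x^k Q_s^(n-k) M + N (telescope).  The exponents
      add up to 2^(s-1) + 2^(s-1) - 1 = 2^s - 1.

    The last two assertions follow from the inclusion of a(M) in b(M)
    (aM_sub_bM).  Let x_(s+1) u be in Q_s M.  By Krull's intersection theorem it
    is enough to work modulo high powers of x_(s+2), ..., x_d, that is, to show
    for a system of parameters a, l_1, ..., l_(d-1) with a u in (l) M that a(M) u
    lies in (l) M (lc_annihilates_colon).  Then u yields a Koszul cocycle c of
    degree d-1 on a, l_1, ..., l_(d-1) with coefficients in M.  Adding generators
    of Ann M to the sequence, one may suppose that every element of m has a power
    in the ideal generated by the sequence.  Let M -> E^0 -> E^1 -> ... be an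
    injective resolution.  A Koszul cochain with values in an injective module
    whose coboundary is m-torsion is the sum of an m-torsion cochain and a
    coboundary (torsion_splitting, which rests on a weak form of the Artin-Rees
    lemma).  Descending the Koszul degree from d-1 to 0 while ascending the
    resolution, one spends one factor from each of a_0, ..., a_(d-1) and finds
    that their product maps c to a coboundary (koszul_chase).

    The ideals a_i(M) are defined through all injective resolutions of M, so one
    must exist: Hom_Z(R, Q/Z) and its powers are injective, and every quotient of
    a module embeds in such a power (embed_quotient). *)

Set Implicit Arguments.
Unset Strict Implicit.
Unset Printing Implicit Defensive.

Import Order.TTheory GRing.Theory Num.Theory.

Local Open Scope classical_set_scope.
Local Open Scope ring_scope.

(** * Maximal subsets by Zorn's lemma *)

(** Zorn's lemma above a given set: the chains whose unions are required to satisfy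
    [P] are nonempty and consist of sets containing [X0]. *)
Lemma zorn_above (T : Type) (P : set (set T)) (X0 : set T) :
    P X0 ->
    (forall F : set (set T), F !=set0 -> F `<=` P ->
       (forall X, F X -> X0 `<=` X) -> total_on F subset ->
       P (\bigcup_(X in F) X)) ->
  exists A, [/\ P A, X0 `<=` A & forall B, P B -> A `<=` B -> B `<=` A].
Proof.
move=> P0 Pch.
have [|A [PA Amax]] := @Zorn_bigcup T [set A | P (X0 `|` A)].
  move=> F FP Ftot /=.
  have [[Y FY]|F0] := pselect (F !=set0); last first.
    rewrite (_ : \bigcup_(X in F) X = set0) ?setU0 //.
    by apply/seteqP; split=> // u [X FX _]; apply: F0; exists X.
  have -> : X0 `|` \bigcup_(X in F) X =
            \bigcup_(X in [set X0 `|` X | X in F]) X.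
    apply/seteqP; split=> u.
      case=> [X0u|[X FX Xu]].
        by exists (X0 `|` Y); [exists Y|left].
      by exists (X0 `|` X); [exists X|right].
    by case=> _ [X FX <-] [?|?]; [left|right; exists X].
  apply: Pch.
  - by exists (X0 `|` Y), Y.
  - by move=> _ [X FX <-]; apply: FP.
  - by move=> _ [X FX <-] u ?; left.
  - move=> _ _ [X FX <-] [Z FZ <-].
    by case: (Ftot _ _ FX FZ) => h; [left|right]; apply: setUS.
exists (X0 `|` A); split=> // B PB AB.
apply: contrapT => nBA; apply: (Amax B); last first.
  by rewrite /= setUidr // => u ?; apply: AB; left.
split=> [u ?|BA]; first by apply: AB; right.
by apply: nBA => u /BA ?; right.
Qed.

(** * Submodules and ideals as sets *)

Section SubmoduleCalculus.
Variables (R : comNzRingType) (V : lmodType R).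
Implicit Types (N P L : set V) (I J : set R).

Lemma scalerC (a b : R) (u : V) : a *: (b *: u) = b *: (a *: u).
Proof. by rewrite !scalerA mulrC. Qed.

Lemma submod0 N : is_submodule N -> N 0. Proof. by case. Qed.
Lemma submodD N u v : is_submodule N -> N u -> N v -> N (u + v).
Proof. by move=> [_ h] hu hv; rewrite -[u]scale1r; apply: h. Qed.
Lemma submodZ N a u : is_submodule N -> N u -> N (a *: u).
Proof. by move=> [N0 h] hu; rewrite -[_ *: _]addr0; apply: h. Qed.
Lemma submodN N u : is_submodule N -> N u -> N (- u).
Proof. by move=> h hu; rewrite -scaleN1r; apply: submodZ. Qed.
Lemma submodB N u v : is_submodule N -> N u -> N v -> N (u - v).
Proof. by move=> h hu hv; apply: submodD => //; apply: submodN. Qed.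
Lemma submodDl N u v : is_submodule N -> N u -> N (u + v) -> N v.
Proof. by move=> h hu /(submodB h)/(_ hu); rewrite addrC addKr. Qed.
Lemma submod_sum N (I : Type) (r : seq I) (Q : pred I) (F : I -> V) :
  is_submodule N -> (forall i, Q i -> N (F i)) -> N (\sum_(i <- r | Q i) F i).
Proof.
move=> h hF; elim/big_ind: _ => //; first exact: submod0.
by move=> *; apply: submodD.
Qed.

Lemma set0_submodule : is_submodule ([set 0] : set V).
Proof. by split=> // a u v /= -> ->; rewrite scaler0 addr0. Qed.

Lemma setT_submodule : is_submodule [set: V]. Proof. by split. Qed.

Lemma setI_submodule N P :
  is_submodule N -> is_submodule P -> is_submodule (N `&` P).
Proof.
move=> hN hP; split; first by split; apply: submod0.
move=> a u v [? ?] [? ?].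
by split; apply: submodD => //; apply: submodZ.
Qed.

Lemma preimage_submodule (W : lmodType R) (f : {linear W -> V}) N :
  is_submodule N -> is_submodule (f @^-1` N).
Proof.
move=> hN; split; first by rewrite /= linear0; apply: submod0.
by move=> a u v /= hu hv; rewrite linearP; apply: submodD => //; apply: submodZ.
Qed.

Lemma range_submodule (W : lmodType R) (f : {linear W -> V}) :
  is_submodule (range f).
Proof.
split; first by exists 0; rewrite ?linear0.
by move=> a _ _ [u _ <-] [v _ <-]; exists (a *: u + v); rewrite ?linearP.
Qed.

Lemma scale_submodule (a : R) : is_submodule [set a *: w | w in [set: V]].
Proof.
split; first by exists 0; rewrite ?scaler0.
move=> c _ _ [u _ <-] [w _ <-]; exists (c *: u + w) => //.
by rewrite scalerDr scalerC.
Qed.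

Lemma colon_submodule N x : is_submodule N -> is_submodule (colon N x).
Proof.
move=> hN; split; first by rewrite /colon /= scaler0; apply: submod0.
move=> a u v; rewrite /colon /= => hu hv; rewrite scalerDr scalerC.
by apply: submodD => //; apply: submodZ.
Qed.

Lemma span_submodule (S : set V) : is_submodule (span S).
Proof.
split=> [N [[]]//|a u v hu hv N hN].
by apply: submodD; [case: hN|apply: submodZ; [case: hN|apply: hu]|apply: hv].
Qed.

Lemma sub_span (S : set V) : S `<=` span S.
Proof. by move=> u Su N [_]; apply. Qed.

Lemma span_min (S : set V) N : is_submodule N -> S `<=` N -> span S `<=` N.
Proof. by move=> hN hS u; apply; split. Qed.

Lemma span_nil u : span [set` [::] : seq V] u -> u = 0.
Proof. by apply: (span_min set0_submodule). Qed.

(** The sum of two submodules. *)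
Definition addS N P : set V := [set u | exists n p, [/\ N n, P p & u = n + p]].

Lemma addS_submodule N P :
  is_submodule N -> is_submodule P -> is_submodule (addS N P).
Proof.
move=> hN hP; split.
  by exists 0, 0; split; rewrite ?addr0 //; apply: submod0.
move=> a _ _ [n [p [Nn Pp ->]]] [n' [p' [Nn' Pp' ->]]].
exists (a *: n + n'), (a *: p + p'); split.
- by apply: submodD => //; apply: submodZ.
- by apply: submodD => //; apply: submodZ.
- by rewrite scalerDr addrACA.
Qed.

Lemma addSl N P : is_submodule P -> N `<=` addS N P.
Proof. by move=> hP u Nu; exists u, 0; split; rewrite ?addr0 //; apply: submod0. Qed.
Lemma addSr N P : is_submodule N -> P `<=` addS N P.
Proof. by move=> hP u Nu; exists 0, u; split; rewrite ?add0r //; apply: submod0. Qed.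
Lemma addS_min N P L : is_submodule L -> N `<=` L -> P `<=` L -> addS N P `<=` L.
Proof. by move=> hL hN hP _ [n [p [Nn Pp ->]]]; apply: submodD; auto. Qed.

(** The cyclic submodule generated by [u]. *)
Definition line (u : V) : set V := [set a *: u | a in setT].
Lemma line_submodule u : is_submodule (line u).
Proof.
split; first by exists 0; rewrite ?scale0r.
by move=> a _ _ [b _ <-] [c _ <-]; exists (a * b + c); rewrite // scalerDl scalerA.
Qed.
Lemma line_id u : line u u. Proof. by exists 1; rewrite ?scale1r. Qed.
Lemma line_min u N : is_submodule N -> N u -> line u `<=` N.
Proof. by move=> hN Nu _ [a _ <-]; apply: submodZ. Qed.

Lemma span_cons x (s : seq V) :
  span [set` x :: s] = addS (line x) (span [set` s]).
Proof.
have h1 := line_submodule x; have h2 := span_submodule [set` s].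
apply/seteqP; split.
  apply: span_min; first exact: addS_submodule.
  move=> u /=; rewrite in_cons => /orP[/eqP ->|us].
    exact/addSl/line_id.
  by apply: addSr => //; apply: sub_span.
apply: addS_min; first exact: span_submodule.
  by apply: line_min; [exact: span_submodule|apply: sub_span; rewrite /= mem_head].
apply: span_min; first exact: span_submodule.
by move=> u us; apply: sub_span; rewrite /= in_cons us orbT.
Qed.

Lemma ideal_scale_submodule I N : is_submodule (ideal_scale I N).
Proof. exact: span_submodule. Qed.

Lemma mem_ideal_scale I N a u : I a -> N u -> ideal_scale I N (a *: u).
Proof. by move=> Ia Nu; apply: sub_span; exists a => //; exists u. Qed.

Lemma ideal_scale_min I N L : is_submodule L ->
  (forall a u, I a -> N u -> L (a *: u)) -> ideal_scale I N `<=` L.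
Proof. by move=> hL h; apply: span_min => // _ [a Ia [u Nu <-]]; apply: h. Qed.

Lemma ideal_scaleS I J N P : I `<=` J -> N `<=` P ->
  ideal_scale I N `<=` ideal_scale J P.
Proof.
move=> IJ NP; apply: ideal_scale_min; first exact: ideal_scale_submodule.
by move=> a u /IJ ? /NP ?; apply: mem_ideal_scale.
Qed.

Lemma ideal_scaleT N : is_submodule N -> ideal_scale setT N = N.
Proof.
move=> hN; apply/seteqP; split.
  by apply: ideal_scale_min => // a u _; apply: submodZ.
by move=> u Nu; rewrite -[u]scale1r; apply: mem_ideal_scale.
Qed.

(** The colon ideal [N : u], the set of scalars that map [u] into [N]. *)
Definition conductor N (u : V) : set R := [set a | N (a *: u)].

Lemma conductor_ideal N u : is_submodule N -> is_ideal (conductor N u).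
Proof.
move=> hN; split; first by rewrite /conductor /= scale0r; apply: submod0.
move=> a b c; rewrite /conductor /= => hb hc.
by rewrite scalerDl -scalerA; apply: submodD => //; apply: submodZ.
Qed.

End SubmoduleCalculus.

Section IdealCalculus.
Variables (R : comNzRingType) (V : lmodType R).
Implicit Types (N : set V) (I J L : set R).

Lemma ideal0 I : is_ideal I -> I 0. Proof. exact: submod0. Qed.
Lemma idealD I a b : is_ideal I -> I a -> I b -> I (a + b).
Proof. exact: (@submodD R R^o). Qed.
Lemma idealB I a b : is_ideal I -> I a -> I b -> I (a - b).
Proof. exact: (@submodB R R^o). Qed.
Lemma idealN I a : is_ideal I -> I a -> I (- a).
Proof. exact: (@submodN R R^o). Qed.
Lemma idealMl I a b : is_ideal I -> I b -> I (a * b).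
Proof. exact: (@submodZ R R^o). Qed.
Lemma idealMr I a b : is_ideal I -> I a -> I (a * b).
Proof. by rewrite mulrC; apply: idealMl. Qed.

Lemma ideal_gen_min (S : set R) I : is_ideal I -> S `<=` I -> ideal_gen S `<=` I.
Proof. exact: (@span_min R R^o). Qed.
Lemma sub_ideal_gen (S : set R) : S `<=` ideal_gen S.
Proof. exact: (@sub_span R R^o). Qed.
Lemma ideal_gen_ideal (S : set R) : is_ideal (ideal_gen S).
Proof. exact: (@span_submodule R R^o). Qed.
Lemma ideal_mul_ideal I J : is_ideal (ideal_mul I J).
Proof. exact: (@span_submodule R R^o). Qed.
Lemma ideal_mul_min I J L : is_ideal L ->
  (forall a b, I a -> J b -> L (a * b)) -> ideal_mul I J `<=` L.
Proof. exact: (@ideal_scale_min R R^o). Qed.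
Lemma mem_ideal_mul I J a b : I a -> J b -> ideal_mul I J (a * b).
Proof. exact: (@mem_ideal_scale R R^o). Qed.
Lemma ideal_pow_ideal I n : is_ideal (ideal_pow I n).
Proof. by case: n => [|n]; [split|exact: ideal_mul_ideal]. Qed.

Lemma ideal_scale_mul I J N :
  ideal_scale (ideal_mul I J) N = ideal_scale I (ideal_scale J N).
Proof.
have h1 := ideal_scale_submodule I (ideal_scale J N).
have h2 := ideal_scale_submodule (ideal_mul I J) N.
apply/seteqP; split; apply: ideal_scale_min => //.
  move=> a u IJa Nu.
  suff: ideal_mul I J `<=` conductor (ideal_scale I (ideal_scale J N)) u by apply.
  apply: ideal_mul_min; first exact: conductor_ideal.
  move=> b c Ib Jc; rewrite /conductor /= -scalerA.
  by apply: mem_ideal_scale => //; apply: mem_ideal_scale.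
move=> a u Ia.
suff: ideal_scale J N `<=` colon (ideal_scale (ideal_mul I J) N) a by apply.
apply: ideal_scale_min; first exact: colon_submodule.
move=> b w Jb Nw; rewrite /colon /= scalerA.
by apply: mem_ideal_scale => //; apply: mem_ideal_mul.
Qed.

Lemma ideal_scale_pow I n N : is_submodule N ->
  ideal_scale (ideal_pow I n) N = iter n (ideal_scale I) N.
Proof.
move=> hN; elim: n => [|n IH]; first exact: ideal_scaleT.
by rewrite /ideal_pow !iterS -/(ideal_pow I n) ideal_scale_mul IH.
Qed.

Lemma ideal_scale_gen (S : set R) N : is_submodule N ->
  ideal_scale (ideal_gen S) N = span [set a *: u | a in S & u in N].
Proof.
move=> hN; apply/seteqP; split.
  apply: ideal_scale_min; first exact: span_submodule.
  move=> a u Sa Nu.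
  suff: ideal_gen S `<=` conductor (span [set a *: u | a in S & u in N]) u by apply.
  apply: ideal_gen_min; first by apply: conductor_ideal; exact: span_submodule.
  by move=> b Sb; apply: sub_span; exists b => //; exists u.
apply: span_min; first exact: ideal_scale_submodule.
by move=> _ [a Sa [u Nu <-]]; apply: mem_ideal_scale => //; apply: sub_ideal_gen.
Qed.

Lemma ideal_scale_span_cons I (x : V) (s : seq V) u : is_ideal I ->
  ideal_scale I (span [set` x :: s]) u ->
  exists c v, [/\ I c, ideal_scale I (span [set` s]) v & u = c *: x + v].
Proof.
move=> hI; have hs := ideal_scale_submodule I (span [set` s]).
pose L : set V := [set u | exists c v,
  [/\ I c, ideal_scale I (span [set` s]) v & u = c *: x + v]].
suff : ideal_scale I (span [set` x :: s]) `<=` L by apply.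
apply: ideal_scale_min.
  split.
    exists 0, 0; split; [exact: ideal0|exact: submod0|].
    by rewrite scale0r addr0.
  move=> b _ _ [c [v [Ic hv ->]]] [c' [v' [Ic' hv' ->]]].
  exists (b * c + c'), (b *: v + v'); split.
  - by apply: idealD => //; apply: idealMl.
  - by apply: (submodD hs) => //; apply: (submodZ _ hs).
  - by rewrite scalerDl scalerDr scalerA addrACA.
move=> b w Ib; rewrite span_cons => -[_ [v [[c _ <-] hv ->]]].
exists (b * c), (b *: v); split.
- exact: idealMr.
- exact: mem_ideal_scale.
- by rewrite scalerDr scalerA.
Qed.

Lemma ideal_powS I (k n : nat) : (k <= n)%N -> ideal_pow I n `<=` ideal_pow I k.
Proof.
move=> /subnK <-; elim: (n - k)%N => [|j IH] //.
apply: subset_trans IH; rewrite addSn.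
apply: ideal_mul_min; first exact: ideal_pow_ideal.
by move=> a b _; apply: idealMl; exact: ideal_pow_ideal.
Qed.

Lemma ideal_pow_mono I J n : I `<=` J -> ideal_pow I n `<=` ideal_pow J n.
Proof.
move=> IJ; elim: n => // n IH; apply: ideal_mul_min; first exact: ideal_mul_ideal.
by move=> a b /IJ ? /IH ?; apply: mem_ideal_mul.
Qed.

Lemma ideal_pow_add_min I j k L : is_ideal L ->
  (forall a b, ideal_pow I j a -> ideal_pow I k b -> L (a * b)) ->
  ideal_pow I (j + k) `<=` L.
Proof.
elim: j L => [|j IH] L hL h.
  by move=> b Ib; rewrite -[b]mul1r; apply: h.
rewrite addSn; apply: ideal_mul_min => // c r Ic.
suff: ideal_pow I (j + k) `<=` conductor (V := R^o) L c.
  by move=> /[apply]; rewrite /conductor /= -[_ *: _]/(r * c) mulrC.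
apply: IH; first by apply: conductor_ideal.
move=> a b Ia Ib; rewrite /conductor /= -[_ *: _]/(a * b * c) mulrC mulrA.
by apply: h => //; apply: mem_ideal_mul.
Qed.

Lemma mem_ideal_pow I n a : I a -> ideal_pow I n (a ^+ n).
Proof.
by move=> Ia; elim: n => [|n IH] //; rewrite exprS; apply: mem_ideal_mul.
Qed.

Lemma ideal_pow1 I : is_ideal I -> ideal_pow I 1 = I.
Proof.
move=> hI; apply/seteqP; split.
  by apply: ideal_mul_min => // a b Ia _; apply: idealMr.
by move=> a Ia; rewrite -[a]mulr1; apply: mem_ideal_mul.
Qed.

(** To place [a] times a product of ideals in an ideal [L] it is enough to consider
    the products of their elements.  The factor [a] is there for the induction. *)
Lemma big_ideal_mul_min n (F : 'I_n -> set R) L (a : R) : is_ideal L ->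
  (forall r : 'I_n -> R, (forall i, F i (r i)) -> L (a * \prod_i r i)) ->
  forall b, (\big[@ideal_mul R/setT]_(i < n) F i) b -> L (a * b).
Proof.
elim: n F a => [|n IH] F a hL h b.
  rewrite big_ord0 => _; apply: idealMr => //.
  by have := h (fun=> 1); rewrite big_ord0 mulr1; apply; case.
rewrite big_ord_recl => hb.
suff: ideal_mul (F ord0) (\big[@ideal_mul R/setT]_(i < n) F (lift ord0 i))
      `<=` conductor (V := R^o) L a.
  by move=> /(_ _ hb); rewrite /conductor /= -[_ *: _]/(b * a) mulrC.
apply: ideal_mul_min; first exact: conductor_ideal.
move=> c r Fc hr; rewrite /conductor /= -[_ *: _]/(c * r * a) mulrC mulrA.
apply: IH hr => // rr hrr.
have := h (fun i => if unlift ord0 i is Some j then rr j else c).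
rewrite big_ord_recl unlift_none mulrA.
rewrite (eq_bigr rr) => [|i _]; last by rewrite liftK.
apply=> i; case: unliftP => [j ->|->] //.
Qed.

End IdealCalculus.

Section Noetherian.
Variable R : comNzRingType.
Hypothesis noeth : noetherian_ring R.

(** Over a Noetherian ring a submodule of a finitely generated module is finitely
    generated: by induction on the number of generators, the coefficients of the
    first generator of the big module form an ideal. *)
Lemma fin_gen_submodule (V : lmodType R) (s : seq V) (L : set V) :
  is_submodule L -> L `<=` span [set` s] -> fin_gen L.
Proof.
elim: s L => [|x s IH] L hL Ls.
  exists [::]; rewrite eqEsubset; split=> //; exact: span_min.
have hs := span_submodule [set` s].
pose I : set R := [set a | exists v, span [set` s] v /\ L (a *: x + v)].
have hI : is_ideal I.
  split; first by exists 0; rewrite scale0r addr0; split; exact: submod0.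
  move=> c a b [v [hv Lv]] [w [hw Lw]]; exists (c *: v + w); split.
    by apply: (submodD hs) => //; apply: (submodZ _ hs).
  rewrite scalerDl -[(c *: a) *: x]scalerA addrACA -scalerDr.
  by apply: (submodD hL) => //; apply: (submodZ _ hL).
have [g gE] := noeth hI.
have [t tE] := IH _ (setI_submodule hL hs) (@subIsetr _ _ _).
have gI a : a \in g -> exists v, span [set` s] v /\ L (a *: x + v).
  by move=> ag; suff : I a by []; rewrite gE; apply: sub_ideal_gen.
have /choice[f hf] : forall a, exists v,
    a \in g -> span [set` s] v /\ L (a *: x + v).
  move=> a; have [/gI[v hv]|na] := boolP (a \in g); first by exists v.
  by exists 0.
exists ([seq a *: x + f a | a <- g] ++ t).
set T := span [set` _]; have hT : is_submodule T by exact: span_submodule.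
apply/seteqP; split; last first.
  apply: span_min => // u /=; rewrite mem_cat => /orP[/mapP[a ag ->]|ut].
    by case: (hf a ag).
  by suff [] : (L `&` span [set` s]) u by []; rewrite tE; apply: sub_span.
have tT : L `&` span [set` s] `<=` T.
  rewrite tE; apply: span_min => // u /= ut.
  by apply: sub_span; rewrite /= mem_cat ut orbT.
move=> u Lu; have := Ls _ Lu; rewrite span_cons => -[_ [v [[a _ <-] hv uE]]].
have Ia : I a by exists v; rewrite -uE.
suff [w [hw Tw]] : exists w, span [set` s] w /\ T (a *: x + w) /\ L (a *: x + w).
  have : (L `&` span [set` s]) (v - w).
    split; last exact: (submodB hs).
    have -> : v - w = u - (a *: x + w) by rewrite uE opprD addrACA subrr add0r.
    by case: Tw => _ Lw; apply: (submodB hL).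
  move=> /tT h; have -> : u = (a *: x + w) + (v - w) by rewrite uE -addrA [w + _]addrC subrK.
  by apply: (submodD hT) => //; case: Tw.
move: Ia; rewrite gE.
pose J : set R^o := [set b | exists w, span [set` s] w /\ T (b *: x + w) /\ L (b *: x + w)].
suff : span (V := R^o) [set` g] `<=` J by apply.
apply: span_min.
  split; first by exists 0; rewrite scale0r addr0; split; [|split]; exact: submod0.
  move=> c b b' [w [hw [Tw Lw]]] [w' [hw' [Tw' Lw']]]; exists (c *: w + w').
  rewrite scalerDl -[(c *: b) *: x]scalerA addrACA -scalerDr.
  split; first by apply: (submodD hs) => //; apply: (submodZ _ hs).
  split; first by apply: (submodD hT) => //; apply: (submodZ _ hT).
  by apply: (submodD hL) => //; apply: (submodZ _ hL).
move=> b /= bg; exists (f b); have [h1 h2] := hf b bg; split=> //; split=> //.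
apply: sub_span; rewrite /= mem_cat; apply/orP; left.
by apply/mapP; exists b.
Qed.

Lemma ascending_chain (V : lmodType R) (L : nat -> set V) :
  fin_gen [set: V] -> (forall k, is_submodule (L k)) ->
  (forall k, L k `<=` L k.+1) -> exists k, forall j, L j `<=` L k.
Proof.
move=> [s sE] hL Lm.
have mono j k : (j <= k)%N -> L j `<=` L k.
  move=> /subnK <-; elim: (k - j)%N => [|i IH] //.
  by by apply: subset_trans IH _; apply: Lm.
have hU : is_submodule (\bigcup_k L k).
  split; first by exists 0%N => //; apply: submod0.
  move=> a u v [j _ hu] [k _ hv]; exists (maxn j k) => //.
  apply: (submodD (hL _)).
    by apply: (submodZ _ (hL _)); apply: mono hu; rewrite leq_maxl.
  by apply: mono hv; rewrite leq_maxr.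
have [|g gE] := @fin_gen_submodule V s _ hU; first by rewrite -sE.
have [k hk] : exists k, forall u, u \in g -> L k u.
  have : forall u, u \in g -> exists k, L k u.
    move=> u ug; have : (\bigcup_k L k) u by rewrite gE; apply: sub_span.
    by case=> k _; exists k.
  clear gE; elim: g => [|u g IH] h; first by exists 0%N.
  have [k hk] := IH (fun v vg => h v (mem_behead (s := u :: g) vg)).
  have [j hj] := h u (mem_head _ _).
  exists (maxn j k) => v; rewrite in_cons => /orP[/eqP ->|vg].
    by apply: mono hj; rewrite leq_maxl.
  by apply: mono (hk v vg); rewrite leq_maxr.
exists k => j u Lu; have : (\bigcup_k L k) u by exists j.
by rewrite gE; apply: span_min.
Qed.

End Noetherian.

(** * Noetherian and local rings *)

(** If [n] exceeds the sum of the [g i], each monomial of degree [n] in the [x i] is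
    divisible by some [x i ^+ (g i).+1]. *)
Lemma pow_pigeonhole (R : comNzRingType) (V : lmodType R) (s : nat)
    (x : 'I_s -> R) (g : 'I_s -> nat) (n : nat) :
  (\sum_i g i < n)%N ->
  ideal_scale (ideal_pow (ideal_gen (range x)) n) [set: V] `<=`
  span [set u | exists i w, u = x i ^+ (g i).+1 *: w].
Proof.
rewrite ideal_scale_pow; last exact: setT_submodule.
elim: n g => [|n IH] g; first by rewrite ltn0.
rewrite ltnS iterS => gn; set L := span _.
have hL : is_submodule L by exact: span_submodule.
rewrite ideal_scale_gen; last first.
  by case: (n) => [|k]; [exact: setT_submodule|exact: ideal_scale_submodule].
apply: span_min => // _ [_ [i _ <-] [w hw <-]].
have [g0|gi] := posnP (g i).
  by apply: sub_span; exists i, w; rewrite g0 expr1.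
pose g' j := if j == i then (g i).-1 else g j.
have g'n : (\sum_j g' j < n)%N.
  apply: leq_trans gn; rewrite (bigD1 i) //= [X in (_ < X)%N](bigD1 i) //=.
  rewrite /g' eqxx (eq_bigr g) => [|j /negbTE -> //].
  by rewrite -addSn prednK.
suff : span [set u | exists i w, u = x i ^+ (g' i).+1 *: w] `<=` colon L (x i).
  by apply; apply: IH hw.
apply: span_min; first exact: colon_submodule.
move=> _ [j [v ->]]; rewrite /colon /= scalerA.
rewrite /g'; case: eqP => [->|_].
  by apply: sub_span; exists i, v; rewrite -exprS prednK.
by rewrite mulrC -scalerA; apply: sub_span; exists j, (x i *: v).
Qed.

Lemma chain_union_submodule (R : comNzRingType) (V : lmodType R)
    (F : set (set V)) :
  F !=set0 -> (forall X, F X -> is_submodule X) -> total_on F subset ->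
  is_submodule (\bigcup_(X in F) X).
Proof.
move=> [Y FY] hF Ftot; split; first by exists Y => //; exact: (submod0 (hF _ FY)).
move=> a u v [X FX Xu] [Z FZ Zv].
have [h|h] := Ftot _ _ FX FZ.
  exists Z => //; have hZ := hF _ FZ.
  by apply: (submodD hZ) => //; apply: (submodZ _ hZ); apply: h.
exists X => //; have hX := hF _ FX.
by apply: (submodD hX); [apply: (submodZ _ hX)|apply: h].
Qed.

Lemma fin_gen_ideal_range (R : comNzRingType) (I : set R) :
  noetherian_ring R -> is_ideal I ->
  exists l (x : 'I_l -> R), I = ideal_gen (range x).
Proof.
move=> noeth /noeth[g gE]; exists (size g), (tnth (in_tuple g)).
rewrite gE /ideal_gen; congr (@span R R^o _); apply/seteqP; split=> a /=.
  by move=> /(tnthP (in_tuple g))[i ->]; exists i.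
by case=> i _ <-; apply: (mem_tnth i (in_tuple g)).
Qed.

(** A weak form of the Artin-Rees lemma: if every element of [m] has a power mapping
    [Z] into [Y], then [m^N F] meets [Z] inside [Y] for some [N].  More precisely
    [m^N F] lies in any submodule [W] that contains [Y] and is maximal subject to
    [W `&` Z `<=` Y]. *)
Lemma weak_artin_rees (R : comNzRingType) (F : lmodType R) (m : set R)
    (Y Z : set F) :
  noetherian_ring R -> fin_gen [set: F] -> is_ideal m ->
  is_submodule Y -> is_submodule Z ->
  (forall a, m a -> exists t, forall z, Z z -> Y (a ^+ t *: z)) ->
  exists W N, [/\ is_submodule W, Y `<=` W, W `&` Z `<=` Y
    & ideal_scale (ideal_pow m N) [set: F] `<=` W].
Proof.
move=> noeth Ffg hm hY hZ hYZ.
pose P (W : set F) := is_submodule W /\ W `&` Z `<=` Y.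
have [||W [[hW WZ] YW Wmax]] := @zorn_above F P Y.
- by split=> // u [].
- move=> C C0 CP _ Ctot; split.
    by apply: chain_union_submodule => // X /CP[].
  by move=> u [[X CX Xu] Zu]; case: (CP _ CX) => _; apply.
have hpow a : m a -> exists k, forall v, W (a ^+ k *: v).
  move=> ma; pose L k := [set v : F | W (a ^+ k *: v)].
  have hL k : is_submodule (L k) by exact: (colon_submodule (a ^+ k) hW).
  have [k hk] : exists k, forall j, L j `<=` L k.
    apply: ascending_chain => // k v; rewrite /L /= => h.
    by rewrite exprS -scalerA; apply: submodZ.
  exists k => v.
  pose aF := [set a ^+ k *: w | w in [set: F]].
  have haF : is_submodule aF by exact: scale_submodule.
  (* by maximality of W it is enough that W + a^k F also meets Z inside Y *)
  have PW' : P (addS W aF).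
    split; first exact: addS_submodule.
    move=> _ [[w [_ [Ww [u _ <-] ->]]] Zz]; apply: WZ; split=> //.
    have [t ht] := hYZ _ ma.
    apply: submodD => //; apply: (hk (t + k)%N); rewrite /L /= exprD -scalerA.
    apply: (submodDl hW (u := a ^+ t *: w)); first exact: submodZ.
    by rewrite -scalerDr; apply/YW/ht.
  apply: (Wmax _ PW'); first exact: addSl.
  by apply: addSr => //; exists v.
have [l [x mE]] := fin_gen_ideal_range noeth hm.
have mx i : m (x i) by rewrite mE; apply: sub_ideal_gen; exists i.
have /choice[g hg] : forall i, exists k, forall v, W (x i ^+ k *: v).
  by move=> i; apply: hpow.
exists W, (\sum_i g i).+1; split=> //.
rewrite mE; apply: subset_trans (@pow_pigeonhole R F l x g _ (ltnSn _)) _.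
apply: span_min => // _ [i [w ->]].
by rewrite exprS -scalerA; apply: submodZ.
Qed.

(** The determinant trick, proved by eliminating one generator at a time: if [a] maps
    the module spanned by [s] into [K] times itself, some element congruent to a
    power of [a] modulo [K] kills that module. *)
Lemma cayley_hamilton_span (R : comNzRingType) (V : lmodType R) (K : set R)
    (s : seq V) (a : R) : is_ideal K ->
  (forall u, u \in s -> ideal_scale K (span [set` s]) (a *: u)) ->
  exists p T, [/\ K (p - a ^+ T) & forall u, span [set` s] u -> p *: u = 0].
Proof.
move=> hK; elim: s a => [|x s IH] a h.
  exists 1, 0%N; split; first by rewrite expr0 subrr; apply: ideal0.
  by move=> u /span_nil ->; rewrite scaler0.
have hs := ideal_scale_submodule K (span [set` s]).
have [c [v [Kc hv axE]]] := ideal_scale_span_cons hK (h x (mem_head _ _)).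
have acx : (a - c) *: x = v by rewrite scalerBl axE addrC addKr.
(* (a - c) x lies in K times the other generators, hence so does the image of
   each of them under a (a - c) *)
have [u us|p [T [hp pann]]] := IH (a * (a - c)).
  have us' : u \in x :: s by rewrite in_cons us orbT.
  have [cu [vu [Kcu hvu auE]]] := ideal_scale_span_cons hK (h u us').
  rewrite mulrC -scalerA auE scalerDr scalerA mulrC -scalerA acx.
  by apply: (submodD hs); apply: (submodZ _ hs).
have pK u : ideal_scale K (span [set` s]) u -> p *: u = 0.
  suff h0 : ideal_scale K (span [set` s]) `<=` colon [set 0] p by move=> /h0.
  apply: ideal_scale_min; first exact/colon_submodule/set0_submodule.
  move=> b w _ hw; rewrite /colon /= scalerC.
  by rewrite (pann w hw) scaler0.
exists (p * (a - c)), (T.*2.+1); split; last first.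
  move=> u; rewrite span_cons => -[_ [w [[b _ <-] hw ->]]].
  rewrite scalerDr -!scalerA [(a - c) *: (b *: x)]scalerC acx.
  rewrite [p *: (b *: v)]scalerC (pK v hv) scaler0 add0r.
  by rewrite scalerC (pann w hw) scaler0.
have congX b b' n : K (b - b') -> K (b ^+ n - b' ^+ n).
  by move=> hb; rewrite subrXX; apply: idealMr.
have h1 : K ((a * (a - c)) ^+ T - a ^+ T.*2).
  rewrite -mul2n exprM; apply: congX.
  rewrite expr2 -mulrBr [a - c - a]addrC addrA addNr add0r mulrN.
  by apply: idealN => //; apply: idealMl.
have h2 : K (p - a ^+ T.*2).
  by rewrite -(subrK ((a * (a - c)) ^+ T) p) -addrA; apply: idealD.
have -> : p * (a - c) - a ^+ T.*2.+1 = (p - a ^+ T.*2) * a - p * c.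
  by rewrite exprSr mulrBr mulrBl addrAC.
by apply: idealB; [|apply: idealMr|apply: idealMl].
Qed.

Section LocalRing.
Variables (R : comNzRingType) (m : set R).
Hypothesis hlocal : local_ring m.

Lemma local_ideal : is_ideal m. Proof. by case: hlocal => -[]. Qed.
Lemma local_proper : ~ m 1. Proof. by case: hlocal => -[]. Qed.

Lemma local_unit a : ~ m a -> exists b, b * a = 1.
Proof.
move=> nma; apply: contrapT => nu.
pose P (I : set R^o) := is_submodule I /\ ~ I (1 : R).
have [||I [[hI I1] aI Imax]] := @zorn_above R^o P (line (a : R^o)).
- split; first exact: line_submodule.
  by case=> b _ ba; apply: nu; exists b.
- move=> C C0 CP _ Ctot; split.
    by apply: chain_union_submodule => // X /CP[].
  by case=> X CX; case: (CP _ CX).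
have Im : I = m.
  case: hlocal => _; apply; split=> // J hJ J1 IJ.
  by rewrite eqEsubset; split=> //; apply: Imax.
by apply: nma; rewrite -Im; apply: aI; apply: line_id.
Qed.

Lemma local_unit1B c : m c -> exists e, e * (1 - c) = 1.
Proof.
move=> mc; apply: local_unit => h1; apply: local_proper.
by rewrite -(subrK c 1); apply: idealD => //; exact: local_ideal.
Qed.

Lemma nakayama (V : lmodType R) (s : seq V) (N : set V) : is_submodule N ->
  span [set` s] `<=` addS (ideal_scale m (span [set` s])) N ->
  span [set` s] `<=` N.
Proof.
have hm := local_ideal.
move=> hN; elim: s => [|x s IH] h; first by move=> u /span_nil ->; apply: submod0.
have hs := span_submodule [set` s].
have hms := ideal_scale_submodule m (span [set` s]).
have hsN := addS_submodule hs hN.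
have xs : addS (span [set` s]) N x.
  have : span [set` x :: s] x by apply: sub_span; rewrite /= mem_head.
  move=> /h[u [n [hu Nn xE]]].
  have [c [v [mc hmv uE]]] := ideal_scale_span_cons hm hu.
  have {hmv}hv : span [set` s] v.
    by move: v hmv {uE}; apply: ideal_scale_min => // b w _; apply: (submodZ _ hs).
  have [e eE] := local_unit1B mc.
  have -> : x = e *: (v + n).
    have -> : v + n = (1 - c) *: x.
      by rewrite scalerBl scale1r {1}xE uE -[c *: x + v + n]addrA [c *: x + _]addrC addrK.
    by rewrite scalerA eE scale1r.
  by apply: (submodZ _ hsN); exists v, n.
have xsub : span [set` x :: s] `<=` addS (span [set` s]) N.
  rewrite span_cons; apply: addS_min => //; first exact: line_min.
  exact: addSl.
have sN : span [set` s] `<=` N.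
  apply: IH => u us.
  have /h[v [n [hv Nn ->]]] : span [set` x :: s] u.
    by rewrite span_cons; apply: addSr => //; exact: line_submodule.
  have hmsN := addS_submodule hms hN.
  apply: (submodD hmsN); last exact: addSr.
  move: v hv; apply: ideal_scale_min => // b w mb /xsub[w1 [n1 [hw1 hn1 ->]]].
  rewrite scalerDr; exists (b *: w1), (b *: n1); split=> //.
    exact: mem_ideal_scale.
  exact: submodZ.
by apply: subset_trans xsub _; apply: addS_min.
Qed.

Section FinitelyGenerated.
Variable V : lmodType R.
Hypothesis Vfg : fin_gen [set: V].

(** Krull's intersection theorem for the quotient by [Q], deduced from the weak
    Artin-Rees lemma for the submodules [Q + m u] and [Q + R u]. *)
Lemma krull_intersection (Q : set V) u : noetherian_ring R -> is_submodule Q ->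
  (forall N, addS Q (ideal_scale (ideal_pow m N) [set: V]) u) -> Q u.
Proof.
move=> noeth hQ hu; have hm := local_ideal.
pose mu : set V := [set c *: u | c in m].
have hmu : is_submodule mu.
  split; first by exists 0; [exact: ideal0|rewrite scale0r].
  move=> a _ _ [b mb <-] [c mc <-]; exists (a * b + c).
    by apply: idealD => //; apply: idealMl.
  by rewrite scalerDl scalerA.
have hY := addS_submodule hQ hmu.
have hZ := addS_submodule hQ (line_submodule u).
have [|W [N [hW YW WZ hN]]] := weak_artin_rees noeth Vfg hm hY hZ.
  move=> a ma; exists 1%N => _ [q [_ [Qq [b _ <-] ->]]].
  rewrite expr1 scalerDr; exists (a *: q), (a *: (b *: u)); split=> //.
    exact: submodZ.
  by rewrite scalerA; exists (a * b) => //; apply: idealMr.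
have [q [_ [Qq [c mc <-] uE]]] : addS Q mu u.
  apply: WZ; split; last by apply: addSr => //; exact: line_id.
  have [q [v [Qq hv uE]]] := hu N.
  by rewrite uE; apply: submodD => //; [apply/YW/addSl|apply: hN].
have [e eE] := local_unit1B mc.
have -> : u = e *: q.
  have -> : q = (1 - c) *: u by rewrite scalerBl scale1r {1}uE addrK.
  by rewrite scalerA eE scale1r.
exact: submodZ.
Qed.

(** The chain of the submodules [a ^+ i V + N] is stationary; Nakayama's lemma then
    gives an [i] with [a ^+ i V] inside [N]. *)
Lemma finite_colength_pow (N : set V) a : is_submodule N ->
  finite_colength N -> m a -> exists t, forall u, N (a ^+ t *: u).
Proof.
move=> hN [b hb] ma; have [s sE] := Vfg.
pose aV i : set V := [set a ^+ i *: w | w in [set: V]].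
have haV i : is_submodule (aV i) by exact: scale_submodule.
pose L i := addS (aV i) N.
have hL i : is_submodule (L i) by exact: addS_submodule.
have Lanti i j : (i <= j)%N -> L j `<=` L i.
  move=> /subnK <-; apply: addS_min => //; last exact: addSr.
  move=> _ [w _ <-]; apply: addSl => //.
  by exists (a ^+ (j - i) *: w) => //; rewrite scalerA -exprD addnC.
have [i hi] : exists i, L i `<=` L i.+1.
  apply: contrapT => nst.
  suff : (b.+1 <= b)%N by rewrite ltnn.
  apply: hb; exists (fun j : 'I_b.+2 => L (b.+1 - j)%N); split.
    by move=> i; split=> //; apply: addSr.
  move=> i j ij; have jb := ltn_ord j; split; first by apply: Lanti; rewrite leq_sub2l // ltnW.
  move=> h; apply: nst; exists (b.+1 - j)%N; apply: subset_trans h _.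
  by apply: Lanti; lia.
exists i.
have aVE : aV i = span [set` map ( *:%R (a ^+ i)) s].
  apply/seteqP; split; last first.
    by apply: span_min => // u /= /mapP[w _ ->]; exists w.
  move=> _ [w _ <-].
  have hsp := span_submodule [set` map ( *:%R (a ^+ i)) s].
  suff : [set: V] `<=` colon (span [set` map ( *:%R (a ^+ i)) s]) (a ^+ i) by apply.
  rewrite sE; apply: span_min; first exact: colon_submodule.
  by move=> u us; apply: sub_span; apply/mapP; exists u.
move=> u; suff : aV i `<=` N by apply; exists u.
rewrite aVE; apply: nakayama => //; rewrite -aVE.
apply: subset_trans (_ : aV i `<=` L i) _; first exact: addSl.
apply: subset_trans hi _; apply: addS_min.
- by apply: addS_submodule => //; exact: ideal_scale_submodule.
- move=> _ [w _ <-]; apply: addSl => //; rewrite exprS -scalerA.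
  by apply: mem_ideal_scale => //; exists w.
- by apply: addSr; exact: ideal_scale_submodule.
Qed.

(** Adding to [N] an element [u] with [m u] inside [N] shortens a chain of submodules
    above [N] by at most one step: of two successive members of the chain, both
    containing [u] or both not containing it, the sums with [R u] are distinct. *)
Lemma finite_colength_step (N : set V) u : is_submodule N ->
  (forall a, m a -> N (a *: u)) -> finite_colength (addS N (line u)) ->
  finite_colength N.
Proof.
move=> hN hmu [b hb]; have hu := line_submodule u.
exists b.+1 => -[//|l] [p [pC pinc]]; rewrite ltnS; apply: hb.
have hp i : is_submodule (p i) by case: (pC i).
have Np i : N `<=` p i by case: (pC i).
have pmono (i j : 'I_l.+2) : (i <= j)%N -> p i `<=` p j.
  rewrite leq_eqVlt => /orP[/eqP/val_inj -> //|/pinc[]//].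
(* the least index whose member contains u, if any *)
have [k hk] : exists k : 'I_l.+2, forall i : 'I_l.+2,
    ((i < k)%N -> ~ p i u) /\ ((k < i)%N -> p k u).
  have [[i0 hi0]|nou] := pselect (exists i, p i u); last first.
    exists ord_max => i; split=> [_ hi|]; first by apply: nou; exists i.
    by rewrite ltnNge -ltnS ltn_ord.
  have exn : exists n, `[< exists i : 'I_l.+2, nat_of_ord i = n /\ p i u >].
    by exists i0; apply/asboolP; exists i0.
  case: (ex_minnP exn) => n /asboolP[k [kn hk]] nmin.
  exists k => i; split=> // ik hi.
  have : (n <= i)%N by apply: nmin; apply/asboolP; exists i.
  by rewrite -kn leqNgt ik.
(* leave out the member of index k, where u enters the chain *)
pose q (i : 'I_l.+1) := addS (p (lift k i)) (line u).
exists q; split=> [i|i j ij].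
  split; first exact: addS_submodule.
  apply: addS_min; first exact: addS_submodule.
    by apply: subset_trans (Np _) _; apply: addSl.
  exact: addSr.
have lij : (lift k i < lift k j)%N by rewrite /= /bump; lia.
have [ij1 ij2] := pinc _ _ lij.
split.
  apply: addS_min; [exact: addS_submodule| |exact: addSr].
  by apply: subset_trans ij1 _; apply: addSl.
move=> qji.
have qj v : p (lift k j) v -> exists w c, [/\ p (lift k i) w & v = w + c *: u].
  move=> pv; have /qji[w [_ [pw [c _ <-] vE]]] : q j v by apply: addSl.
  by exists w, c.
have [jk|kj] := ltnP (lift k j) k.
  apply: ij2 => v pv; have [w [c [pw vE]]] := qj v pv.
  rewrite vE; apply: (submodD (hp _)) => //.
  have [mc|nmc] := pselect (m c); first exact/Np/hmu.
  have [e eE] := local_unit nmc; exfalso; apply: (proj1 (hk _) jk).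
  rewrite -[u]scale1r -eE -scalerA; apply: (submodZ _ (hp _)).
  have -> : c *: u = v - w by rewrite vE addrC addKr.
  by apply: (submodB (hp _)) => //; apply: ij1.
have neq : (nat_of_ord k != lift k j)%N by rewrite -[_ == _]/(k == lift k j) neq_lift.
have {neq}kj : (k < lift k j)%N by rewrite ltn_neqAle neq.
have pku := proj2 (hk _) kj.
have [i' [ii' i'j pi'u]] : exists i' : 'I_l.+2,
    [/\ (lift k i <= i')%N, (i' < lift k j)%N & p i' u].
  have [ik|ki] := leqP (lift k i) k; first by exists k.
  by exists (lift k i); split=> //; apply: pmono (ltnW ki) _ pku.
have [_ nij] := pinc _ _ i'j; apply: nij => v /qj[w [c [pw ->]]].
by apply: (submodD (hp _)); [apply: pmono ii' _ pw|apply: (submodZ _ (hp _))].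
Qed.

Lemma finite_colength_top : finite_colength [set: V].
Proof.
exists 0%N => -[//|l] [p [pC pinc]].
have [_ []] := pinc ord0 (lift ord0 ord0) isT.
by case: (pC ord0) => _; apply: subset_trans; apply: subsetT.
Qed.

(** Induction on [T] along the submodules [N + m^i (span s)].  The passage from one
    of them to the next adds finitely many generators, each of them mapped by [m]
    into the smaller submodule. *)
Lemma finite_colength_layers T (s : seq V) (N : set V) :
  noetherian_ring R -> is_submodule N ->
  ideal_scale (ideal_pow m T) (span [set` s]) `<=` N ->
  finite_colength (addS N (span [set` s])) -> finite_colength N.
Proof.
move=> noeth hN; have hm := local_ideal.
elim: T s => [|T IH] s.
  have hs := span_submodule [set` s].
  rewrite ideal_scaleT // => sN; rewrite (_ : addS N _ = N) //.
  by rewrite eqEsubset; split; [apply: addS_min|apply: addSl].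
have hs := span_submodule [set` s].
rewrite ideal_scale_pow // iterSr => hT hfc.
have [g gE] := noeth _ hm.
pose s' := [seq a *: u | a <- g, u <- s].
have s'E : ideal_scale m (span [set` s]) = span [set` s'].
  apply/seteqP; split; last first.
    apply: span_min; first exact: ideal_scale_submodule.
    move=> _ /allpairsP[[a u] /= [ag us ->]]; apply: mem_ideal_scale.
      by rewrite gE; apply: (@sub_span R R^o).
    exact: sub_span.
  apply: ideal_scale_min; first exact: span_submodule.
  move=> a u ma; suff : span [set` s] `<=` colon (span [set` s']) a by apply.
  apply: span_min; first by apply: colon_submodule; exact: span_submodule.
  move=> w /= ws; suff : m `<=` conductor (span [set` s']) w by apply.
  rewrite gE; apply: (@span_min R R^o).
    by apply: conductor_ideal; exact: span_submodule.
  move=> b bg; apply: sub_span; apply/allpairsP.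
  by exists (b, w).
apply: (IH s'); rewrite -s'E.
  by rewrite ideal_scale_pow //; exact: ideal_scale_submodule.
set N' := addS N _.
have hms := ideal_scale_submodule m (span [set` s]).
have hN' : is_submodule N' by exact: addS_submodule.
suff H (r : seq V) : (forall u, u \in r -> u \in s) ->
    finite_colength (addS N' (span [set` r])) -> finite_colength N'.
  apply: (H s) => //; rewrite (_ : addS N' _ = addS N (span [set` s])) //.
  have hNs := addS_submodule hN hs.
  rewrite eqEsubset; split.
    apply: addS_min => //; last exact: addSr.
    apply: addS_min => //; first exact: addSl.
    apply: subset_trans (_ : _ `<=` span [set` s]) _; last exact: addSr.
    by apply: ideal_scale_min => // a u _; apply: submodZ.
  have hh := addS_submodule hN' hs.
  apply: addS_min => //; last exact: addSr.
  by apply: subset_trans (_ : N `<=` N') _; apply: addSl.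
elim: r => [|u r IHr] rs.
  rewrite (_ : addS N' _ = N') // eqEsubset; split; last first.
    by apply: addSl; exact: span_submodule.
  by apply: addS_min => // u /span_nil ->; exact: submod0.
have hr := span_submodule [set` r].
move=> h; apply: IHr => [v vr|]; first by apply: rs; rewrite in_cons vr orbT.
have hNr := addS_submodule hN' hr.
have hlu := line_submodule u.
apply: (@finite_colength_step _ u) => //.
  move=> a ma; apply: addSl => //; apply: addSr => //.
  by apply: mem_ideal_scale => //; apply: sub_span; apply: rs; rewrite mem_head.
rewrite (_ : addS _ _ = addS N' (span [set` u :: r])) // span_cons.
have h2 := addS_submodule hlu hr.
have h1 := addS_submodule hN' h2.
have h3 := addS_submodule hNr hlu.
rewrite eqEsubset; split.
  apply: addS_min => //.
    apply: addS_min => //; first exact: addSl.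
    by apply: subset_trans (_ : _ `<=` addS (line u) (span [set` r])) _; apply: addSr.
  apply: subset_trans (_ : _ `<=` addS (line u) (span [set` r])) _; last exact: addSr.
  exact: addSl.
apply: addS_min => //.
  by apply: subset_trans (_ : _ `<=` addS N' (span [set` r])) _; apply: addSl.
apply: addS_min => //; first exact: addSr.
apply: subset_trans (_ : _ `<=` addS N' (span [set` r])) _; last exact: addSl.
exact: addSr.
Qed.

(** Over a Noetherian local ring with maximal ideal [m], a quotient of a finitely
    generated module has finite length if and only if each element of [m] acts
    nilpotently on it. *)
Lemma finite_colengthP (N : set V) : noetherian_ring R -> is_submodule N ->
  finite_colength N <-> forall a, m a -> exists t, forall u, N (a ^+ t *: u).
Proof.
move=> noeth hN; have hm := local_ideal; split=> [h a ma|h].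
  exact: finite_colength_pow.
have [l [x mE]] := fin_gen_ideal_range noeth hm.
have mx i : m (x i) by rewrite mE; apply: sub_ideal_gen; exists i.
have /choice[g hg] : forall i, exists k, forall v, N (x i ^+ k *: v).
  by move=> i; apply: h.
have [s sE] := Vfg.
apply: (@finite_colength_layers (\sum_i g i).+1 s) => //; rewrite -sE.
  rewrite mE; apply: subset_trans (@pow_pigeonhole R V l x g _ (ltnSn _)) _.
  apply: span_min => // _ [i [w ->]].
  by rewrite exprS -scalerA; apply: submodZ.
rewrite (_ : addS _ _ = [set: V]); first exact: finite_colength_top.
by rewrite eqEsubset; split=> //; apply: addSr.
Qed.

End FinitelyGenerated.
End LocalRing.

(** * Enough injectives *)

Lemma zmod_morphismD (U W : zmodType) (f : U -> W) : zmod_morphism f ->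
  forall u v, f (u + v) = f u + f v.
Proof.
move=> fB u v; have f0 : f 0 = 0 by have := fB 0 0; rewrite !subrr.
by rewrite -{1}(opprK v) fB -[- v]sub0r fB f0 sub0r opprK.
Qed.

Section CharacterExtension.
Variables (B D : zmodType).
Hypothesis Ddiv : forall (n : nat) (d : D), (0 < n)%N -> exists e, e *+ n = d.

(** The graphs of additive maps with values in [D] that are defined on a subgroup
    of [B]. *)
Definition partial_char (G : set (B * D)) : Prop :=
  [/\ G 0, forall p q, G p -> G q -> G (p - q)
         & forall d, G (0, d) -> d = 0].

(** A divisible group is injective as an abelian group. *)
Lemma partial_char_ext (G0 : set (B * D)) : partial_char G0 ->
  exists chi : B -> D,
    zmod_morphism chi /\ forall p, G0 p -> chi p.1 = p.2.
Proof.
move=> G0c.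
have [|G [[G1 GB Gf] G0G Gmax]] := zorn_above G0c.
  move=> F [Y FY] FP _ Ftot; split.
  - by exists Y => //; case: (FP _ FY).
  - move=> p q [X FX Xp] [Z FZ Zq].
    case: (Ftot _ _ FX FZ) => h; [exists Z|exists X] => //.
      by case: (FP _ FZ) => _ hB _; apply: hB => //; apply: h.
    by case: (FP _ FX) => _ hB _; apply: hB => //; apply: h.
  - by move=> d [X FX Xd]; case: (FP _ FX) => _ _; apply.
have GN p : G p -> G (- p) by move=> Gp; rewrite -sub0r; apply: GB.
have GD p q : G p -> G q -> G (p + q).
  by move=> Gp Gq; rewrite -(opprK q); apply: GB => //; apply: GN.
have GMn p n : G p -> G (p *+ n).
  by move=> Gp; elim: n => [|n IH]; rewrite ?mulr0n // mulrS; apply: GD.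
have GMz p (k : int) : G p -> G (p *~ k).
  by move=> Gp; case: k => n; [apply: GMn|rewrite NegzE mulrNz; apply/GN/GMn].
have Gu b d1 d2 : G (b, d1) -> G (b, d2) -> d1 = d2.
  move=> h1 h2; apply/eqP; rewrite -subr_eq0; apply/eqP/Gf.
  by have := GB _ _ h1 h2; rewrite -[X in G X]/(b - b, d1 - d2) subrr.
have pMz (b : B) (d : D) (k : int) : (b, d) *~ k = (b *~ k, d *~ k).
  have pMn (n : nat) : (b, d) *+ n = (b *+ n, d *+ n).
    by elim: n => [|n IH] //; rewrite !mulrS IH.
  case: k => n; first exact: pMn.
  by rewrite NegzE !mulrNz -!pmulrn pMn.
have Gtot b : exists d, G (b, d).
  (* a value for b that is consistent with G on the multiples of b in its domain *)
  have [e He] : exists e, forall (k : int) d, G (b *~ k, d) -> d = e *~ k.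
    (* divide the value of G at the least positive multiple of b in its domain *)
    have [[n0 [n0p [d0 hd0]]]|nn] :=
        pselect (exists n : nat, (0 < n)%N /\ exists d, G (b *+ n, d)).
      have exn : exists n : nat, (0 < n)%N && `[< exists d, G (b *+ n, d) >].
        by exists n0; rewrite n0p; apply/asboolP; exists d0.
      case: (ex_minnP exn) => n /andP[n0' /asboolP[dn hdn]] nmin.
      have [e ene] := Ddiv dn n0'; exists e => k d Gk.
      have kE := divz_eq k n.
      have nz : (n : int) != 0 by rewrite -lt0n in n0' *.
      have r0 := modz_ge0 k nz.
      have rn : (k %% n)%Z < n by rewrite ltz_pmod.
      have Gr : G (b *~ (k %% n)%Z, d - dn *~ (k %/ n)%Z).
        have := GB _ _ Gk (GMz _ (k %/ n)%Z hdn); rewrite pMz.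
        rewrite -[X in G X]/(b *~ k - (b *+ n) *~ (k %/ n)%Z, d - dn *~ (k %/ n)%Z).
        by rewrite {1}kE mulrzDr pmulrn -mulrzA mulrC addrC addKr.
      have k0 : (k %% n)%Z = 0.
        move: r0 rn Gr; case: (k %% n)%Z => // r _ rn Gr.
        case: r => [|r] // in rn Gr *.
        have := nmin r.+1; rewrite /= ; move: rn; rewrite ltz_nat ltnNge => /negP rn.
        move=> h; exfalso; apply: rn; apply: h; apply/asboolP.
        by exists (d - dn *~ (k %/ n)%Z).
      have := Gf (d - dn *~ (k %/ n)%Z); rewrite k0 in Gr; move=> /(_ Gr)/eqP.
      rewrite subr_eq0 => /eqP ->.
      by rewrite [in RHS]kE k0 addr0 mulrC mulrzA -pmulrn ene.
    exists 0 => k d Gk; rewrite mul0rz.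
    have k0 : k = 0.
      case: k Gk => n Gk; last first.
        exfalso; apply: nn; exists n.+1; split=> //; exists (- d).
        by have := GN _ Gk; rewrite -[X in G X]/(- (b *~ _), - d) NegzE mulrNz opprK.
      case: n Gk => [//|n] Gk.
      by exfalso; apply: nn; exists n.+1; split=> //; exists d.
    by apply: Gf; rewrite k0 in Gk.
  pose G' : set (B * D) := [set p | exists q (k : int), G q /\ p = q + (b, e) *~ k].
  have G'c : partial_char G'.
    split.
    - by exists 0, 0; rewrite addr0.
    - move=> _ _ [q [k [Gq ->]]] [q' [k' [Gq' ->]]].
      exists (q - q'), (k - k'); split; first exact: GB.
      by rewrite mulrzBr opprD addrACA.
    - move=> d [[q1 q2] [k [Gq]]]; rewrite pMz => -[h1 ->].
      have := He (- k) q2; rewrite !mulrNz => -> ; first by rewrite addNr.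
      by move/eqP: h1; rewrite eq_sym addr_eq0 => /eqP <-.
  exists e; apply: (Gmax _ G'c) => [p Gp|]; first by exists p, 0; rewrite addr0.
  by exists 0, 1; rewrite add0r.
have [chi hchi] := choice Gtot.
exists chi; split.
  by move=> x y; apply: (Gu (x - y)) => //; apply: (GB _ _ (hchi x) (hchi y)).
by move=> [b d] Gp /=; apply: (Gu b) => //; apply: G0G.
Qed.
End CharacterExtension.

(** The integers as a subgroup of the rationals. *)
Definition rat_int : pred rat := fun q => q \is a Num.int.

Fact rat_int_zmod_closed : zmod_closed rat_int.
Proof. by split=> [|x y]; rewrite !unfold_in; [apply: rpred0|apply: rpredB]. Qed.

HB.instance Definition _ :=
  GRing.isZmodClosed.Build rat rat_int rat_int_zmod_closed.

(** The group Q/Z. *)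
Definition QmodZ : zmodType :=
  Quotient.quot (GRing.ZmodClosed.clone _ rat_int _).

Lemma QmodZ_surj (d : QmodZ) : exists q : rat, d = (\pi_QmodZ q)%qT.
Proof. by exists (repr d); rewrite reprK. Qed.

Lemma QmodZ_piMn (q : rat) n :
  (\pi_QmodZ (q *+ n) = (\pi_QmodZ q) *+ n)%qT.
Proof. exact: raddfMn. Qed.

Lemma QmodZ_pi_eq0 (q : rat) : (\pi_QmodZ q == 0)%qT = (q \is a Num.int).
Proof.
rewrite -(raddf0 (\pi_QmodZ)%qT).
by rewrite -[LHS]Quotient.idealrBE subr0.
Qed.

Lemma QmodZ_div (n : nat) (d : QmodZ) : (0 < n)%N -> exists e, e *+ n = d.
Proof.
move=> n0; have [q ->] := QmodZ_surj d.
exists (\pi_QmodZ (q / n%:R))%qT; rewrite -QmodZ_piMn -[_ *+ n]mulr_natr divfK //.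
by rewrite pnatr_eq0 -lt0n.
Qed.

(** Q/Z has nonzero elements of order dividing [n]; for [n = 0] this only says that
    it is nonzero. *)
Lemma QmodZ_tors (n : nat) :
  n != 1%N -> exists2 q : QmodZ, q != 0 & q *+ n = 0.
Proof.
move=> n1; pose k := if n == 0%N then 2%N else n.
have k1 : (1 < k)%N by rewrite /k; case: eqP => // /eqP; case: n n1 {k} => [|[]].
have kn : (k %| n)%N by rewrite /k; case: eqP => [->|].
exists (\pi_QmodZ (k%:R^-1))%qT.
  rewrite QmodZ_pi_eq0; apply/negP => /intrP[z zE].
  have k0 : (0 : rat) < k%:R by rewrite ltr0n (ltn_trans _ k1).
  have h0 : (0 : rat) < z%:~R by rewrite -zE invr_gt0.
  have h1 : (z%:~R : rat) < 1 by rewrite -zE invf_lt1 // ltr1n.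
  rewrite ltr0z in h0; rewrite ltrz1 in h1.
  by move: h0 h1; case: z {zE} => [[|z]|z].
apply/eqP; rewrite -QmodZ_piMn QmodZ_pi_eq0 -[_ *+ n]mulr_natl.
case/dvdnP: kn => j ->; rewrite natrM mulfK ?rpred_nat //.
by rewrite pnatr_eq0 -lt0n (ltn_trans _ k1).
Qed.

(** The characters with values in Q/Z that vanish on a subgroup separate its
    cosets. *)
Lemma separating_char (V : zmodType) (N : set V) (v : V) :
  N 0 -> (forall p q, N p -> N q -> N (p - q)) -> ~ N v ->
  exists chi : V -> QmodZ,
    [/\ zmod_morphism chi, forall u, N u -> chi u = 0 & chi v != 0].
Proof.
move=> N0 NB Nv.
have ND p q : N p -> N q -> N (p + q).
  by move=> h1 h2; rewrite -(opprK q); apply: (NB) => //; rewrite -sub0r; apply: NB.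
have NMn p k : N p -> N (p *+ k).
  by move=> h; elim: k => [|k IH]; rewrite ?mulr0n // mulrS; apply: ND.
have NMz p (k : int) : N p -> N (p *~ k).
  move=> h; case: k => k; first exact: NMn.
  by rewrite NegzE mulrNz -sub0r; apply: NB => //; apply: NMn.
have [q q0 qann] : exists2 q : QmodZ,
    q != 0 & forall k : int, N (v *~ k) -> q *~ k = 0.
  have [[n0 [n0p hn0]]|nn] :=
      pselect (exists n : nat, (0 < n)%N /\ N (v *+ n)).
    have exn : exists n : nat, (0 < n)%N && `[< N (v *+ n) >].
      by exists n0; rewrite n0p; apply/asboolP.
    case: (ex_minnP exn) => n /andP[np /asboolP hn] nmin.
    have n1 : n != 1%N by apply/eqP => n1; rewrite n1 in hn.
    have [q q0 qn] := QmodZ_tors n1; exists q => // k Nk.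
    have nz : (n : int) != 0 by rewrite -lt0n in np *.
    have rn : (k %% n)%Z < n by rewrite ltz_pmod.
    have r0 := modz_ge0 k nz.
    have Nr : N (v *~ (k %% n)%Z).
      have := NB _ _ Nk (NMz _ (k %/ n)%Z hn).
      by rewrite {1}(divz_eq k n) mulrzDr pmulrn -mulrzA mulrC addrC addKr.
    have k0 : (k %% n)%Z = 0.
      move: r0 rn Nr; case: (k %% n)%Z => // -[|r] // _ rn Nr.
      move: rn; rewrite ltz_nat ltnNge => /negP rn; exfalso; apply: rn.
      by apply: nmin; apply/asboolP.
    by rewrite (divz_eq k n) k0 addr0 mulrC mulrzA -pmulrn qn mul0rz.
  have [q q0 _] := @QmodZ_tors 0%N isT.
  exists q => // k Nk; case: k Nk => [[|n]|n] Nk //.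
    by exfalso; apply: nn; exists n.+1.
  exfalso; apply: nn; exists n.+1; split=> //.
  by have := NB _ _ N0 Nk; rewrite NegzE mulrNz sub0r opprK.
(* map N to 0 and v to q *)
pose G : set (V * QmodZ) :=
  [set p | exists u (k : int), N u /\ p = (u + v *~ k, q *~ k)].
have Gc : partial_char G.
  split.
  - by exists 0, 0; split=> //; rewrite !mulr0z addr0.
  - move=> _ _ [u [k [Nu ->]]] [u' [k' [Nu' ->]]].
    exists (u - u'), (k - k'); split; first exact: NB.
    rewrite -[LHS]/(u + v *~ k - (u' + v *~ k'), q *~ k - q *~ k').
    by rewrite !mulrzBr opprD addrACA.
  - move=> d [u [k [Nu [h ->]]]]; apply: qann.
    have -> : v *~ k = 0 - u by rewrite h addrC addKr.
    exact: NB.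
have [chi [chiB chiG]] := partial_char_ext QmodZ_div Gc.
exists chi; split=> // [u Nu|].
  by apply: (chiG (u, 0)); exists u, 0; split=> //; rewrite !mulr0z addr0.
by rewrite (chiG (v, q)) //; exists 0, 1; split=> //; rewrite add0r.
Qed.

(** Packs a map and a proof of its linearity into the type of linear maps. *)
Lemma linear_bundle (R : comNzRingType) (A B : lmodType R) (f : A -> B) :
  (forall a u v, f (a *: u + v) = a *: f u + f v) ->
  exists g : {linear A -> B}, forall u, g u = f u.
Proof.
move=> fl.
pose fM := GRing.isLinear.Build R A B _ f fl.
pose g : {linear A -> B} := HB.pack f fM.
by exists g.
Qed.

Section Coinduced.
Variables (R : comNzRingType) (I : Type).

(** A family of maps from [R] to Q/Z belongs to [coind] if each of them is
    additive. *)
Definition coind_pred : pred (I -> R -> QmodZ) :=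
  fun phi => `[< forall i, zmod_morphism (phi i) >].

Fact coind_zmod_closed : zmod_closed coind_pred.
Proof.
split=> [|p q]; rewrite !unfold_in.
  by apply/asboolP => i x y; rewrite /= subr0.
move=> /asboolP hp /asboolP hq; apply/asboolP => i x y.
by rewrite !fctE hp hq !opprD addrACA opprK.
Qed.

HB.instance Definition _ :=
  GRing.isZmodClosed.Build (I -> R -> QmodZ) coind_pred coind_zmod_closed.

(** The product, over the index type [I], of copies of the coinduced module
    Hom_Z(R, Q/Z). *)
Record coind := Coind { coind_val :> I -> R -> QmodZ; _ : coind_pred coind_val }.

HB.instance Definition _ := [isSub for coind_val].
HB.instance Definition _ := [Choice of coind by <:].
HB.instance Definition _ := [SubChoice_isSubZmodule of coind by <:].

Lemma coind_additive (phi : coind) i : zmod_morphism (phi i).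
Proof. by case: phi => phi /= /asboolP. Qed.

Lemma coind_ext (p q : coind) : (forall i x, p i x = q i x) -> p = q.
Proof. by move=> h; apply: val_inj; apply/funext => i; apply/funext => x; apply: h. Qed.

Lemma coindD (p q : coind) i x : (p + q) i x = p i x + q i x.
Proof. by []. Qed.

Lemma coind_argD (p : coind) i x y : p i (x + y) = p i x + p i y.
Proof. exact: (zmod_morphismD (coind_additive p i)). Qed.

Fact coind_scale_subproof (a : R) (p : coind) :
  coind_pred (fun i x => p i (x * a)).
Proof. by apply/asboolP => i x y; rewrite mulrBl coind_additive. Qed.

(** The action of [R] by translation of the argument: [(a phi) x = phi (x a)]. *)
Definition coind_scale (a : R) (p : coind) : coind :=
  Coind (coind_scale_subproof a p).

Fact coind_scaleA a b p : coind_scale a (coind_scale b p) = coind_scale (a * b) p.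
Proof. by apply: coind_ext => i x /=; rewrite mulrA. Qed.
Fact coind_scale1 : left_id 1 coind_scale.
Proof. by move=> p; apply: coind_ext => i x /=; rewrite mulr1. Qed.
Fact coind_scaleDr : right_distributive coind_scale +%R.
Proof. by move=> a p q; apply: coind_ext => i x. Qed.
Fact coind_scaleDl p : {morph coind_scale^~ p : a b / a + b}.
Proof. by move=> a b; apply: coind_ext => i x; rewrite coindD /= mulrDr coind_argD. Qed.

HB.instance Definition _ := GRing.Zmodule_isLmodule.Build R coind
  coind_scaleA coind_scale1 coind_scaleDr coind_scaleDl.

(** Linear maps into [coind] correspond to families of characters, by evaluation
    at [1]; hence they extend as characters do. *)
Lemma coind_injective : injective_module coind.
Proof.
move=> A B f g finj.
have ext i : exists psi : B -> QmodZ,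
    zmod_morphism psi /\ forall a, psi (f a) = g a i 1.
  pose G : set (B * QmodZ) := [set p | exists a, p = (f a, g a i 1)].
  have [|psi [psiB psiG]] := @partial_char_ext B QmodZ QmodZ_div G.
    split.
    - by exists 0; rewrite !linear0.
    - by move=> _ _ [a ->] [b ->]; exists (a - b); rewrite !linearB.
    - move=> d [a [h ->]].
      have -> : a = 0 by apply: finj; rewrite linear0.
      by rewrite linear0.
  by exists psi; split=> // a; apply: (psiG (f a, g a i 1)); exists a.
have [psi psiP] := choice ext.
have psiD i := zmod_morphismD (psiP i).1.
have hP b : coind_pred (fun i x => psi i (x *: b)).
  by apply/asboolP => i x y; rewrite scalerBl (psiP i).1.
have [|h hE] := @linear_bundle R B coind (fun b => Coind (hP b)).
  move=> a u v; apply: coind_ext => i x.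
  change (psi i (x *: (a *: u + v)) = psi i ((x * a) *: u) + psi i (x *: v)).
  by rewrite scalerDr psiD scalerA.
exists h => a; rewrite hE; apply: coind_ext => i x /=.
rewrite -linearZ (psiP i).2 linearZ.
by change (g a i (1 * x) = g a i x); rewrite mul1r.
Qed.

End Coinduced.

Section EnoughInjectives.
Variable R : comNzRingType.

(** Every quotient V / N embeds in an injective module.  The quotient is not formed:
    the embedding is a linear map on [V] with kernel [N]. *)
Lemma embed_quotient (V : lmodType R) (N : set V) : is_submodule N ->
  exists E : lmodType R, injective_module E /\
    exists d : {linear V -> E}, N = d @^-1` [set 0].
Proof.
move=> Nsub; have [N0 NS] := Nsub.
have NB p q : N p -> N q -> N (p - q).
  by move=> hp hq; rewrite addrC -scaleN1r; apply: NS.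
pose chars := {chi : V -> QmodZ | zmod_morphism chi /\ forall u, N u -> chi u = 0}.
exists (coind R chars); split; first exact: coind_injective.
have hP v : coind_pred (fun (i : chars) (x : R) => sval i (x *: v)).
  by apply/asboolP => i x y; rewrite scalerBl (svalP i).1.
have charD (i : chars) := zmod_morphismD (svalP i).1.
have [|d dE] := @linear_bundle R V (coind R chars) (fun v => Coind (hP v)).
  move=> a u v; apply: coind_ext => i x.
  change (sval i (x *: (a *: u + v)) =
          sval i ((x * a) *: u) + sval i (x *: v)).
  by rewrite scalerDr charD scalerA.
exists d; apply/seteqP; split=> v.
  move=> Nv /=; rewrite dE; apply: coind_ext => i x /=.
  by apply: (svalP i).2; rewrite -[_ *: _]addr0; apply: NS.
rewrite /= dE => dv0; apply: contrapT => Nv.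
have [chi [chiB chiN chiv]] := separating_char N0 NB Nv.
have := congr1 (fun p : coind R chars => p (exist _ chi (conj chiB chiN)) 1) dv0.
by rewrite /= scale1r => h; rewrite h eqxx in chiv.
Qed.

(** A module together with a submodule; it stands for the quotient module in the
    construction of resolutions, and for the submodule itself in [sub_type]. *)
Record mod_pair := Pair {
  pair_mod : lmodType R;
  pair_sub : set pair_mod;
  pair_subP : is_submodule pair_sub }.

(** An injective module in which the quotient given by [s] embeds. *)
Definition next_mod (s : mod_pair) : lmodType R :=
  projT1 (cid (embed_quotient (pair_subP s))).

Lemma next_mod_injective s : injective_module (next_mod s).
Proof. exact: (projT2 (cid (embed_quotient (pair_subP s)))).1. Qed.

(** A linear map from the ambient module of [s] to [next_mod s] with kernel the
    submodule of [s]. *)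
Definition next_map (s : mod_pair) : {linear pair_mod s -> next_mod s} :=
  projT1 (cid (projT2 (cid (embed_quotient (pair_subP s)))).2).

Lemma next_map_ker s : @pair_sub s = next_map s @^-1` [set 0].
Proof. exact: projT2 (cid (projT2 (cid (embed_quotient (pair_subP s)))).2). Qed.

(** The cokernel of the embedding of the quotient given by [s] into [next_mod s]. *)
Definition next_pair (s : mod_pair) : mod_pair :=
  Pair (range_submodule (next_map s)).

Lemma injective_resolution_exists (M : lmodType R) :
  inhabited (injective_resolution M).
Proof.
pose s0 := Pair (set0_submodule M).
pose st i := iter i next_pair (next_pair s0).
have aug_inj : injective (next_map s0).
  move=> u v h; apply/eqP; rewrite -subr_eq0; apply/eqP.
  have : (next_map s0 @^-1` [set 0]) (u - v) by rewrite /= linearB h subrr.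
  by rewrite -next_map_ker.
have inj i : injective_module (pair_mod (st i)).
  by case: i => [|i]; apply: next_mod_injective.
constructor; apply: (@InjectiveResolution R M (fun i => pair_mod (st i))
  (next_map s0) (fun i => next_map (st i))) => //.
  by rewrite -next_map_ker.
by move=> i; rewrite -(next_map_ker (st i.+1)).
Qed.

End EnoughInjectives.

(** * Cochain complexes and local cohomology *)

Section SubmoduleType.
Variables (R : comNzRingType) (P : mod_pair R).

Definition sub_pred : pred (pair_mod P) := fun u => `[< pair_sub u >].

Fact sub_pred_closed : submod_closed sub_pred.
Proof.
split; first by apply/asboolP; exact: (submod0 (pair_subP P)).
move=> a u v; rewrite !unfold_in => /asboolP hu /asboolP hv; apply/asboolP.
exact: (proj2 (pair_subP P)).
Qed.

HB.instance Definition _ :=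
  GRing.isSubmodClosed.Build R (pair_mod P) sub_pred sub_pred_closed.

(** The submodule of a pair, as a module in its own right. *)
Record sub_type := SubType { sub_val : pair_mod P; _ : sub_pred sub_val }.

HB.instance Definition _ := [isSub for sub_val].
HB.instance Definition _ := [Choice of sub_type by <:].
HB.instance Definition _ := [SubChoice_isSubLmodule of sub_type by <:].

End SubmoduleType.

(** Extension to an injective module in relational form: [G] is the graph of a linear
    map defined on a submodule of [F], and no quotient or submodule appears in the
    statement. *)
Lemma linear_relation_ext (R : comNzRingType) (F E : lmodType R)
    (G : F -> E -> Prop) :
  injective_module E -> G 0 0 ->
  (forall a u v e e', G u e -> G v e' -> G (a *: u + v) (a *: e + e')) ->
  (forall e, G 0 e -> e = 0) ->
  exists h : {linear F -> E}, forall u e, G u e -> h u = e.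
Proof.
move=> Einj G0 Glin Gf.
pose Z : set F := [set u | exists e, G u e].
have hZ : is_submodule Z.
  split; first by exists 0.
  by move=> a u v [e he] [e' he']; exists (a *: e + e'); apply: Glin.
have Gu u e e' : G u e -> G u e' -> e = e'.
  move=> h h'; apply/eqP; rewrite -subr_eq0; apply/eqP/Gf.
  have := Glin (-1) _ _ _ _ h' h.
  by rewrite !scaleN1r addNr addrC.
pose P := Pair hZ.
have hsub (x : sub_type P) : exists e, G (val x) e by case: x => x /= /asboolP.
have [phi hphi] := choice hsub.
have [|f fE] := @linear_bundle R (sub_type P) E phi.
  move=> a u v; apply: (Gu (val (a *: u + v))); first exact: hphi.
  by rewrite linearP; apply: Glin; apply: hphi.
have [|h hE] := Einj _ _ (val : {linear sub_type P -> F}) f; first exact: val_inj.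
exists h => u e ue.
have Zu : sub_pred (P := P) u by apply/asboolP; exists e.
have := hE (SubType Zu); rewrite /= fE => ->.
by apply: Gu ue; apply: (hphi (SubType Zu)).
Qed.

Section Cochains.
Variables (R : comNzRingType) (N : nat).
Implicit Types (D H : 'M[R]_N) (E : lmodType R).

(** The coboundary of a cochain with values in [E], for the complex of free modules
    whose differential has matrix [D].  All degrees are put together in one free
    module of rank [N]; a degree function on the basis records the grading. *)
Definition cobd E D (f : 'I_N -> E) (i : 'I_N) : E := \sum_j D i j *: f j.

(** The evaluation of a cochain on a chain. *)
Definition pairing E (f : 'I_N -> E) (z : 'rV[R]_N) : E := \sum_j z 0 j *: f j.

Lemma cobdZ E D a (f : 'I_N -> E) i :
  cobd D (fun j => a *: f j) i = a *: cobd D f i.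
Proof. by rewrite /cobd scaler_sumr; apply: eq_bigr => j _; rewrite scalerC. Qed.

Lemma cobdB E D (f g : 'I_N -> E) i :
  cobd D (fun j => f j - g j) i = cobd D f i - cobd D g i.
Proof. by rewrite /cobd -sumrB; apply: eq_bigr => j _; rewrite scalerBr. Qed.

Lemma cobd_map E E' (phi : {linear E -> E'}) D (f : 'I_N -> E) i :
  cobd D (fun j => phi (f j)) i = phi (cobd D f i).
Proof. by rewrite linear_sum; apply: eq_bigr => j _; rewrite linearZ. Qed.

Lemma cobd_cobd E D (f : 'I_N -> E) i : D *m D = 0 ->
  cobd D (cobd D f) i = 0.
Proof.
move=> DD; rewrite /cobd; under eq_bigr => j _ do rewrite scaler_sumr.
rewrite exchange_big big1 // => k _.
under eq_bigr => j _ do rewrite scalerA.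
rewrite -scaler_suml; have := congr1 (fun A : 'M_N => A i k) DD.
by rewrite !mxE => ->; rewrite scale0r.
Qed.

Lemma cobd_submod E D (f : 'I_N -> E) (S : set E) i :
  is_submodule S -> (forall j, S (f j)) -> S (cobd D f i).
Proof. by move=> hS hf; apply: submod_sum => // j _; apply: submodZ. Qed.

Fact pairing_is_linear E (f : 'I_N -> E) a u v :
  pairing f (a *: u + v) = a *: pairing f u + pairing f v.
Proof.
rewrite /pairing scaler_sumr -big_split; apply: eq_bigr => j _.
by rewrite !mxE scalerDl scalerA.
Qed.

Lemma pairing_mulmx E D (f : 'I_N -> E) z :
  pairing f (z *m D) = pairing (cobd D f) z.
Proof.
rewrite /pairing; under [RHS]eq_bigr => j _ do rewrite /cobd scaler_sumr.
rewrite exchange_big; apply: eq_bigr => k _; rewrite mxE scaler_suml.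
by apply: eq_bigr => j _; rewrite scalerA.
Qed.

Lemma pairing_delta E (f : 'I_N -> E) i : pairing f (delta_mx 0 i) = f i.
Proof.
rewrite /pairing (bigD1 i) //= mxE !eqxx scale1r big1 ?addr0 // => j /negbTE ji.
by rewrite mxE ji scale0r.
Qed.

Lemma torsion_submodule (m : set R) E : is_submodule (torsion m (E := E)).
Proof.
split; first by exists 0%N => a _; rewrite scaler0.
move=> a u v [k hk] [l hl]; exists (maxn k l) => b hb.
rewrite scalerDr scalerC hk ?scaler0 ?add0r; last first.
  by apply: ideal_powS hb; rewrite leq_maxl.
by apply: hl; apply: ideal_powS hb; rewrite leq_maxr.
Qed.

Lemma torsion_map (m : set R) E E' (phi : {linear E -> E'}) u :
  torsion m u -> torsion m (phi u).
Proof. by move=> [k hk]; exists k => a /hk h; rewrite -linearZ h linear0. Qed.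

Lemma rV_fin_gen : fin_gen [set: 'rV[R]_N].
Proof.
exists [seq delta_mx 0 i | i <- enum 'I_N].
rewrite eqEsubset; split=> // u _; rewrite (row_sum_delta u).
have hs := span_submodule [set` [seq delta_mx 0 i : 'rV[R]_N | i <- enum 'I_N]].
apply: submod_sum => // i _; apply: (submodZ _ hs); apply: sub_span.
by apply/mapP; exists i; rewrite ?mem_enum.
Qed.

Variable m : set R.
Hypotheses (noeth : noetherian_ring R) (hm : is_ideal m).

(** If each element of [m] has a power that acts on the complex as a null-homotopic
    map, a cochain with values in an injective module and with torsion coboundary is
    the sum of a torsion cochain and a coboundary. *)
Lemma torsion_splitting E D (f : 'I_N -> E) :
  injective_module E -> D *m D = 0 ->
  (forall a, m a -> exists t H, D *m H + H *m D = (a ^+ t)%:M) ->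
  (forall i, torsion m (cobd D f i)) ->
  exists g h : 'I_N -> E,
    (forall i, torsion m (g i)) /\ forall i, f i = g i + cobd D h i.
Proof.
move=> Einj DD hD tors.
have [pf pfE] := linear_bundle (pairing_is_linear f).
(* Z is the module of cycles, and Y the part of it on which f vanishes; the
   homotopies and the torsion hypothesis show that powers of elements of m map
   Z into Y. *)
pose Z : set 'rV[R]_N := [set z | z *m D = 0].
have hZ : is_submodule Z.
  split; first by rewrite /Z /= mul0mx.
  by move=> a u v; rewrite /Z /= mulmxDl -scalemxAl => -> ->; rewrite scaler0 addr0.
pose Y := Z `&` (pf @^-1` [set 0]).
have hY : is_submodule Y.
  by apply: setI_submodule => //; apply: preimage_submodule; exact: set0_submodule.
have hYZ a : m a -> exists t, forall z, Z z -> Y (a ^+ t *: z).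
  move=> ma; have [t [H HE]] := hD _ ma.
  have /choice[n hn] : forall i, exists n, forall b, ideal_pow m n b -> b *: cobd D f i = 0.
    by move=> i; have [n] := tors i; exists n.
  exists (\max_i n i + t)%N => z Zz; split; first exact: submodZ.
  have zE : a ^+ t *: z = (z *m H) *m D.
    by rewrite -mul_mx_scalar -HE mulmxDr !mulmxA Zz mul0mx add0r.
  rewrite /= exprD -scalerA zE linearZ /= pfE pairing_mulmx /pairing scaler_sumr.
  apply: big1 => j _; rewrite scalerC hn ?scaler0 //.
  by apply: ideal_powS (mem_ideal_pow _ ma); apply: leq_bigmax.
have [W [T [hW YW WZ hT]]] := weak_artin_rees noeth rV_fin_gen hm hY hZ hYZ.
(* g agrees with f on the cycles and vanishes on W, hence on m^T times the free
   module: its values are torsion. *)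
have [|||g gE] := @linear_relation_ext R 'rV[R]_N E
  (fun u e => exists z w, [/\ Z z, W w, u = z + w & e = pf z]) Einj.
- by exists 0, 0; rewrite !addr0 linear0; split=> //; apply: submod0.
- move=> a u v e e' [z [w [Zz Ww -> ->]]] [z' [w' [Zz' Ww' -> ->]]].
  exists (a *: z + z'), (a *: w + w'); split.
  + by apply: (submodD hZ) => //; apply: (submodZ _ hZ).
  + by apply: (submodD hW) => //; apply: (submodZ _ hW).
  + by rewrite scalerDr addrACA.
  + by rewrite linearP.
- move=> e [z [w [Zz Ww h ->]]]; suff [_ ?] : Y z by [].
  apply: WZ; split=> //; have -> : z = - w by apply/eqP; rewrite -addr_eq0 -h.
  exact: submodN.
have gW w : W w -> g w = 0.
  move=> Ww; apply: gE; exists 0, w; rewrite add0r linear0; split=> //.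
  exact: submod0.
have gZ z : Z z -> g z = pf z.
  by move=> Zz; apply: gE; exists z, 0; rewrite addr0; split=> //; apply: submod0.
(* f - g vanishes on the cycles, hence factors through the boundaries. *)
have [|||h hE] := @linear_relation_ext R 'rV[R]_N E
  (fun u e => exists w, u = w *m D /\ e = pf w - g w) Einj.
- by exists 0; rewrite mul0mx (linear0 pf) (linear0 g) subr0.
- move=> a u v e e' [w [-> ->]] [w' [-> ->]]; exists (a *: w + w').
  by rewrite mulmxDl -scalemxAl (linearP pf) (linearP g) opprD scalerBr addrACA.
- move=> e [w [wD ->]]; have Zw : Z w by [].
  by rewrite gZ // subrr.
exists (fun i => g (delta_mx 0 i)), (fun i => h (delta_mx 0 i)); split=> i.
  exists T => a ha; rewrite -linearZ; apply: gW; apply: hT.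
  exact: mem_ideal_scale.
have -> : cobd D (fun j => h (delta_mx 0 j)) i = h (delta_mx 0 i *m D).
  rewrite cobd_map; congr (h _); rewrite -rowE (row_sum_delta (row i D)).
  by apply: eq_bigr => j _; rewrite mxE.
rewrite (hE _ (pf (delta_mx 0 i) - g (delta_mx 0 i))); last first.
  by exists (delta_mx 0 i).
by rewrite addrC subrK pfE pairing_delta.
Qed.

Variable deg : 'I_N -> nat.

(** The preceding decomposition for a cochain concentrated in degrees at most [p]:
    the two cochains found may be truncated. *)
Lemma torsion_splitting_deg E D (f : 'I_N -> E) p :
  injective_module E -> D *m D = 0 ->
  (forall i j, D i j != 0 -> deg i = (deg j).+1) ->
  (forall a, m a -> exists t H, D *m H + H *m D = (a ^+ t)%:M) ->
  (forall i, torsion m (cobd D f i)) ->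
  (forall i, (p < deg i)%N -> f i = 0) ->
  exists g h : 'I_N -> E,
    [/\ forall i, torsion m (g i),
        forall i, (p <= deg i)%N -> h i = 0
      & forall i, f i = g i + cobd D h i].
Proof.
move=> Einj DD hdeg hD tors f0.
have [g [h [gt fE]]] := torsion_splitting Einj DD hD tors.
exists (fun i => if (deg i <= p)%N then g i else 0),
       (fun i => if (deg i < p)%N then h i else 0); split=> i.
- by case: ifP => // _; apply: submod0; exact: torsion_submodule.
- by rewrite leqNgt => /negbTE ->.
- case: leqP => ip.
    rewrite fE; congr (_ + _); apply: eq_bigr => j _.
    have [->|/hdeg ij] := eqVneq (D i j) 0; first by rewrite !scale0r.
    by rewrite -ij ip.
  rewrite f0 // add0r /cobd big1 // => j _.
  have [->|/hdeg ij] := eqVneq (D i j) 0; first by rewrite !scale0r.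
  by rewrite -ij leqNgt ip scaler0.
Qed.

End Cochains.

Section Chase.
Variables (R : comNzRingType) (m : set R) (M : lmodType R) (N : nat).
Variables (D : 'M[R]_N) (deg : 'I_N -> nat).
Hypotheses (noeth : noetherian_ring R) (hm : is_ideal m).
Hypotheses (DD : D *m D = 0)
  (hdeg : forall i j, D i j != 0 -> deg i = (deg j).+1)
  (hD : forall a, m a -> exists t H, D *m H + H *m D = (a ^+ t)%:M).
Variable Er : injective_resolution M.

Lemma res_diff_diff q u : res_diff Er q.+1 (res_diff Er q u) = 0.
Proof.
have : range (res_diff Er q) (res_diff Er q u) by exists u.
by rewrite res_exactS.
Qed.

Lemma res_exact_lift q u : res_diff Er q.+1 u = 0 ->
  exists w, res_diff Er q w = u.
Proof.
move=> hu; have : (res_diff Er q.+1 @^-1` [set 0]) u by [].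
by rewrite -res_exactS => -[w _ <-]; exists w.
Qed.

Lemma lc_coboundaries_submodule q : is_submodule (@lc_coboundaries R m M Er q).
Proof.
case: q => [|q]; first exact: set0_submodule.
have ht := @torsion_submodule R m (res_mod Er q).
split; first by exists 0; [exact: submod0|rewrite linear0].
move=> a _ _ [u hu <-] [v hv <-]; exists (a *: u + v); last by rewrite linearP.
by apply: (submodD ht) => //; apply: (submodZ _ ht).
Qed.

Lemma lc_coboundaries_torsion q u :
  @lc_coboundaries R m M Er q u -> torsion m u.
Proof.
case: q u => [|q] u; first by move=> ->; apply: submod0; exact: torsion_submodule.
by move=> [w hw <-]; apply: torsion_map.
Qed.

(** Let [f] be a cochain in degrees below [p] with values in the cocycles of the
    resolution at [q], whose coboundary has values in the local cohomology
    coboundaries.  A product of elements of [a_q, ..., a_(q+p-1)] maps [f] to a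
    coboundary modulo local cohomology coboundaries.  For the induction, write [f]
    as a torsion cochain plus the coboundary of [h]; then the differential of [h] is
    a cochain of the same kind at [q.+1], one degree lower. *)
Lemma koszul_chase p q (f : 'I_N -> res_mod Er q) (r : nat -> R) :
  (forall k, (k < p)%N -> ai m M (q + k) (r k)) ->
  (forall i, (p <= deg i)%N -> f i = 0) ->
  (forall i, res_diff Er q (f i) = 0) ->
  (forall i, @lc_coboundaries R m M Er q (cobd D f i)) ->
  exists g b : 'I_N -> res_mod Er q,
    [/\ forall i, res_diff Er q (g i) = 0,
        forall i, @lc_coboundaries R m M Er q (b i)
      & forall i, (\prod_(k < p) r k) *: f i = cobd D g i + b i].
Proof.
elim: p q f r => [|p IH] q f r hr f0 df cf.
  exists (fun=> 0), (fun=> 0); split=> i.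
  - exact: linear0.
  - by apply: submod0; exact: lc_coboundaries_submodule.
  - by rewrite f0 // scaler0 /cobd big1 ?addr0 // => j _; rewrite scaler0.
have [|g [h [gt h0 fE]]] :=
    torsion_splitting_deg noeth hm (res_injective (i := q)) DD hdeg hD _ f0.
  by move=> i; apply: lc_coboundaries_torsion.
have [||||g' [b' [dg' cb' IHE]]] :=
    IH q.+1 (fun i => res_diff Er q (h i)) (fun k => r k.+1).
- by move=> k kp; rewrite addSnnS; apply: hr.
- by move=> i /h0 ->; rewrite linear0.
- by move=> i; apply: res_diff_diff.
- move=> i; rewrite cobd_map; exists (- g i).
    by apply: submodN => //; exact: torsion_submodule.
  have -> : cobd D h i = f i - g i by rewrite fE addrC addKr.
  by rewrite linearN linearB df sub0r.
have /choice[k kE] : forall i, exists w, res_diff Er q w = g' i.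
  by move=> i; apply: res_exact_lift.
have /choice[e eE] : forall i, exists w, torsion m w /\ res_diff Er q w = b' i.
  by move=> i; have [w] := cb' i; exists w.
set P := \prod_(k < p) r k.+1 in IHE.
pose g1 i := P *: h i - cobd D k i - e i.
pose w i := P *: g i + cobd D e i.
have dg1 i : res_diff Er q (g1 i) = 0.
  rewrite !linearB linearZ /= IHE -cobd_map (eE i).2.
  have -> : cobd D (fun j => res_diff Er q (k j)) i = cobd D g' i.
    by apply: eq_bigr => j _; rewrite kE.
  by rewrite [X in X - _]addrC addKr subrr.
(* w is a torsion cochain with values in the cocycles, which r 0 maps to the
   local cohomology coboundaries *)
have wE i : P *: f i = w i + cobd D g1 i.
  rewrite !cobdB cobdZ cobd_cobd // subr0 /w fE scalerDr.
  by rewrite -addrA [cobd D e i + _]addrC subrK.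
have wt i : torsion m (w i).
  have ht := @torsion_submodule R m (res_mod Er q).
  apply: (submodD ht); first exact: (submodZ _ ht).
  by apply: cobd_submod => // j; case: (eE j).
have dw i : res_diff Er q (w i) = 0.
  have -> : w i = P *: f i - cobd D g1 i by rewrite wE addrK.
  rewrite linearB linearZ /= df scaler0 sub0r -cobd_map /cobd big1 ?oppr0 //.
  by move=> j _; rewrite dg1 scaler0.
exists (fun i => r 0%N *: g1 i), (fun i => r 0%N *: w i); split=> i.
- by rewrite linearZ /= dg1 scaler0.
- have := hr 0%N isT; rewrite addn0 => /(_ Er); apply.
  by split; [exact: wt|exact: dw].
- by rewrite big_ord_recl -scalerA wE scalerDr cobdZ addrC.
Qed.

Lemma lc_annihilates p (c : 'I_N -> M) (r : nat -> R) :
  (forall k, (k < p)%N -> ai m M k (r k)) ->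
  (forall i, (p <= deg i)%N -> c i = 0) ->
  (forall i, cobd D c i = 0) ->
  exists g : 'I_N -> M, forall i, (\prod_(k < p) r k) *: c i = cobd D g i.
Proof.
move=> hr c0 dc.
have [||||g [b [dg b0 hE]]] := @koszul_chase p 0 (fun i => res_aug Er (c i)) r.
- exact: hr.
- by move=> i /c0 ->; rewrite linear0.
- move=> i; have : range (res_aug Er) (res_aug Er (c i)) by exists (c i).
  by rewrite res_exact0.
- by move=> i; rewrite cobd_map dc linear0.
have /choice[g' g'E] : forall i, exists w, res_aug Er w = g i.
  move=> i; have : (res_diff Er 0%N @^-1` [set 0]) (g i) by apply: dg.
  by rewrite -res_exact0 => -[w _ <-]; exists w.
exists g' => i; apply: (@res_aug_inj _ _ Er).
rewrite -cobd_map linearZ /= hE (b0 i) addr0.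
by apply: eq_bigr => j _; rewrite g'E.
Qed.
End Chase.

(** * Koszul complexes *)

Section Koszul.
Variable R : comNzRingType.
Implicit Types (a : R) (l : seq R) (M : lmodType R).

(** The number of subsets of the index set of [l]. *)
Fixpoint koszul_rank l : nat :=
  if l is _ :: l' then (koszul_rank l' + koszul_rank l')%N else 1%N.

(** The matrix of the Koszul differential, built as an iterated mapping cone.  In the
    complex of [a :: l] the first block of indices stands for the subsets without
    [a], the second one for the subsets with [a]. *)
Fixpoint koszul_mx l : 'M[R]_(koszul_rank l) :=
  if l is a :: l' then block_mx (koszul_mx l') 0 a%:M (- koszul_mx l') else 0.

(** The cardinality of a subset. *)
Fixpoint koszul_deg l : 'I_(koszul_rank l) -> nat :=
  if l is _ :: l' return 'I_(koszul_rank l) -> nat then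
    fun i : 'I_(koszul_rank l' + koszul_rank l') =>
      match fintype.split i with
      | inl j => koszul_deg j
      | inr j => (koszul_deg j).+1
      end
  else fun=> 0%N.

(** The subset of all indices. *)
Fixpoint koszul_top l : 'I_(koszul_rank l) :=
  if l is _ :: l' return 'I_(koszul_rank l) then rshift _ (koszul_top l')
  else ord0.

Lemma koszul_degl a l i : koszul_deg (l := a :: l) (lshift _ i) = koszul_deg i.
Proof. by rewrite /= (unsplitK (inl i)). Qed.
Lemma koszul_degr a l i : koszul_deg (l := a :: l) (rshift _ i) = (koszul_deg i).+1.
Proof. by rewrite /= (unsplitK (inr i)). Qed.

Lemma koszul_deg_top l : koszul_deg (koszul_top l) = size l.
Proof. by elim: l => //= a l IH; rewrite (unsplitK (inr _)) IH. Qed.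

Lemma koszul_mx_sq l : koszul_mx l *m koszul_mx l = 0.
Proof.
elim: l => [|a l IH] /=; first by rewrite mul0mx.
rewrite mulmx_block !mulNmx !mulmxN !IH !mul0mx !mulmx0 !oppr0 !addr0.
by rewrite scalar_mxC subrr block_mx0.
Qed.

Lemma koszul_mx_deg l i j : koszul_mx l i j != 0 ->
  koszul_deg i = (koszul_deg j).+1.
Proof.
elim: l i j => [|a l IH] i j; first by rewrite mxE eqxx.
rewrite -(splitK i) -(splitK j).
case: (fintype.split i) => {}i; case: (fintype.split j) => {}j; rewrite /unsplit;
  rewrite ?koszul_degl ?koszul_degr /=.
- by rewrite block_mxEul => /IH.
- by rewrite block_mxEur mxE eqxx.
- rewrite block_mxEdl mxE; case: (eqVneq i j) => [-> //|_].
  by rewrite eqxx.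
- by rewrite block_mxEdr mxE oppr_eq0 => /IH ->.
Qed.

(** Multiplication by an element of the ideal generated by [l] is null-homotopic. *)
Lemma koszul_homotopy l b : ideal_gen [set` l] b ->
  exists H, koszul_mx l *m H + H *m koszul_mx l = b%:M.
Proof.
pose I : set R := [set b | exists H, koszul_mx l *m H + H *m koszul_mx l = b%:M].
suff : ideal_gen [set` l] `<=` I by apply.
apply: ideal_gen_min.
  split; first by exists 0; rewrite mul0mx mulmx0 addr0 raddf0.
  move=> c b1 b2 [H1 h1] [H2 h2]; exists (c *: H1 + H2).
  rewrite mulmxDr mulmxDl -scalemxAl -scalemxAr addrACA -scalerDr h1 h2.
  by rewrite -[c *: b1]/(c * b1) scale_scalar_mx raddfD.
move=> {b} b /=; rewrite {}/I /=; elim: l => [//|a l IH].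
rewrite in_cons => /orP[/eqP ->|bl].
  exists (block_mx 0 1%:M 0 0); rewrite /= !mulmx_block.
  rewrite !mulmx0 !mul0mx !mulmx1 !mul1mx !addr0 !add0r add_block_mx.
  by rewrite !add0r !addr0 subrr -scalar_mx_block.
have [H hH] := IH bl.
exists (block_mx H 0 0 (- H)); rewrite /= !mulmx_block.
rewrite !mulmx0 !mul0mx !mulNmx !mulmxN !opprK !addr0 !add0r add_block_mx hH.
by rewrite ?addr0 scalar_mxC subrr -scalar_mx_block.
Qed.

Section Top.
Variable M : lmodType R.

(** The cochain of a mapping cone with the two given components. *)
Definition cat_cochain n (f g : 'I_n -> M) (i : 'I_(n + n)) : M :=
  match fintype.split i with inl j => f j | inr j => g j end.

Lemma cat_cochainl n (f g : 'I_n -> M) i : cat_cochain f g (lshift _ i) = f i.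
Proof. by rewrite /cat_cochain (unsplitK (inl i)). Qed.
Lemma cat_cochainr n (f g : 'I_n -> M) i : cat_cochain f g (rshift _ i) = g i.
Proof. by rewrite /cat_cochain (unsplitK (inr i)). Qed.

Lemma cobd_consl a l (f : 'I_(koszul_rank (a :: l)) -> M) i :
  cobd (koszul_mx (a :: l)) f (lshift _ i) =
  cobd (koszul_mx l) (fun j => f (lshift _ j)) i.
Proof.
rewrite /cobd big_split_ord /= [X in _ + X]big1 ?addr0.
  by apply: eq_bigr => j _; rewrite block_mxEul.
by move=> j _; rewrite block_mxEur mxE scale0r.
Qed.

Lemma cobd_consr a l (f : 'I_(koszul_rank (a :: l)) -> M) i :
  cobd (koszul_mx (a :: l)) f (rshift _ i) =
  a *: f (lshift _ i) - cobd (koszul_mx l) (fun j => f (rshift _ j)) i.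
Proof.
rewrite /cobd big_split_ord /=; congr (_ + _).
  rewrite (bigD1 i) //= block_mxEdl mxE eqxx big1 ?addr0 // => j /negbTE ji.
  by rewrite block_mxEdl mxE eq_sym ji scale0r.
rewrite -sumrN; apply: eq_bigr => j _.
by rewrite block_mxEdr mxE scaleNr.
Qed.

(** The cochain with value [u] at the top index and zero elsewhere. *)
Definition single l (u : M) (i : 'I_(koszul_rank l)) : M :=
  if i == koszul_top l then u else 0.

Lemma single_consl a l u i : single (l := a :: l) u (lshift _ i) = 0.
Proof. by rewrite /single /= eq_lrshift. Qed.
Lemma single_consr a l u i : single (l := a :: l) u (rshift _ i) = single u i.
Proof. by rewrite /single /= (inj_eq (@rshift_inj _ _)). Qed.

Lemma cobd_single l u i : cobd (koszul_mx l) (single u) i = 0.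
Proof.
elim: l i => [|a l IH] i.
  by rewrite /cobd big1 // => j _; rewrite mxE scale0r.
rewrite -(splitK i); case: (fintype.split i) => {}i; rewrite /unsplit.
  by rewrite cobd_consl /cobd big1 // => j _; rewrite single_consl scaler0.
rewrite cobd_consr single_consl scaler0 sub0r -[RHS]oppr0 -[in RHS](IH i).
by congr (- _); apply: eq_bigr => j _; rewrite single_consr.
Qed.

(** The submodule [(l_1, ..., l_n) M]. *)
Definition seq_mul l : set M := ideal_scale (ideal_gen [set` l]) [set: M].

Lemma seq_mul_submodule l : is_submodule (seq_mul l).
Proof. exact: ideal_scale_submodule. Qed.

Lemma mem_seq_mul l a u : a \in l -> seq_mul l (a *: u).
Proof. by move=> al; apply: mem_ideal_scale => //; apply: sub_ideal_gen. Qed.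

Lemma seq_mul_min l (N : set M) : is_submodule N ->
  (forall a u, a \in l -> N (a *: u)) -> seq_mul l `<=` N.
Proof.
move=> hN h; rewrite /seq_mul ideal_scale_gen; last exact: setT_submodule.
by apply: span_min => // _ [a al [u _ <-]]; apply: h.
Qed.

Lemma seq_mul_cons a l u : seq_mul (a :: l) u ->
  exists w v, seq_mul l v /\ u = a *: w + v.
Proof.
have hl := seq_mul_submodule l.
suff : seq_mul (a :: l) `<=` [set u | exists w v, seq_mul l v /\ u = a *: w + v].
  by apply.
apply: seq_mul_min.
  split; first by exists 0, 0; rewrite scaler0 addr0; split=> //; exact: submod0.
  move=> c _ _ [w [v [hv ->]]] [w' [v' [hv' ->]]].
  exists (c *: w + w'), (c *: v + v'); split.
    by apply: (submodD hl) => //; apply: (submodZ _ hl).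
  by rewrite !scalerDr scalerC addrACA.
move=> b w; rewrite in_cons => /orP[/eqP ->|bl].
  by exists w, 0; rewrite addr0; split=> //; exact: submod0.
by exists 0, (b *: w); rewrite scaler0 add0r; split=> //; apply: mem_seq_mul.
Qed.

Lemma seq_mulS l l' : {subset l <= l'} -> seq_mul l `<=` seq_mul l'.
Proof.
move=> ll'; apply: seq_mul_min; first exact: seq_mul_submodule.
by move=> a u /ll' al; apply: mem_seq_mul.
Qed.

Lemma cobd_top l (f : 'I_(koszul_rank l) -> M) :
  seq_mul l (cobd (koszul_mx l) f (koszul_top l)).
Proof.
elim: l f => [|a l IH] f.
  rewrite /cobd big1 => [|j _]; last by rewrite mxE scale0r.
  by apply: submod0; exact: seq_mul_submodule.
have hl := seq_mul_submodule (a :: l).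
rewrite [koszul_top _]/(rshift _ _) cobd_consr; apply: (submodB hl).
  by apply: mem_seq_mul; rewrite mem_head.
by apply: seq_mulS (IH _) => b bl; rewrite in_cons bl orbT.
Qed.

(** The top Koszul cohomology is the quotient of [M] by [seq_mul l]. *)
Lemma cobd_onto_top l v : seq_mul l v ->
  exists g : 'I_(koszul_rank l) -> M,
    (forall i, (size l <= koszul_deg i)%N -> g i = 0) /\
    forall i, cobd (koszul_mx l) g i = single v i.
Proof.
elim: l v => [|a l IH] v hv.
  have -> : v = 0.
    suff : seq_mul [::] `<=` [set (0 : M)] by apply.
    by apply: seq_mul_min => //; exact: set0_submodule.
  exists (fun=> 0); split=> // i; rewrite /single if_same /cobd big1 // => j _.
  by rewrite scaler0.
have [w [v' [hv' ->]]] := seq_mul_cons hv.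
have [g [g0 gE]] := IH _ hv'.
exists (cat_cochain (single w) (fun i => - g i)); split=> i;
  rewrite -(splitK i); case: (fintype.split i) => {}i; rewrite /unsplit.
- rewrite koszul_degl cat_cochainl /single; case: eqP => // ->.
  by rewrite koszul_deg_top ltnn.
- by rewrite koszul_degr cat_cochainr => /g0 ->; rewrite oppr0.
- rewrite cobd_consl single_consl -[RHS](cobd_single w i).
  by apply: eq_bigr => j _; rewrite cat_cochainl.
- rewrite cobd_consr single_consr cat_cochainl.
  have -> : cobd (koszul_mx l) (fun j => cat_cochain (single w) (fun i => - g i)
       (rshift (koszul_rank l) j)) i = - cobd (koszul_mx l) g i.
    by rewrite -sumrN; apply: eq_bigr => j _; rewrite cat_cochainr scalerN.
  by rewrite opprK gE /single; case: eqP => // _; rewrite scaler0 addr0.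
Qed.

(** An element [u] of the colon [seq_mul l : a] is a component of a Koszul cocycle of
    [a :: l], and [r u] lies in [seq_mul l] if [r] maps this cocycle to a coboundary.
    Since the members of [zs] kill [M], extension by zero gives a cocycle of
    [zs ++ a :: l] with the same property. *)
Lemma colon_cocycle (zs : seq R) a l u :
  (forall z w, z \in zs -> z *: (w : M) = 0) -> seq_mul l (a *: u) ->
  exists c : 'I_(koszul_rank (zs ++ a :: l)) -> M,
    [/\ forall i, (size l < koszul_deg i)%N -> c i = 0,
        forall i, cobd (koszul_mx (zs ++ a :: l)) c i = 0
      & forall r g, (forall i, r *: c i = cobd (koszul_mx (zs ++ a :: l)) g i) ->
          seq_mul l (r *: u)].
Proof.
move=> + hu; elim: zs => [_|z zs IH hz].
  have [g [g0 gE]] := cobd_onto_top hu.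
  exists (cat_cochain (single u) g); split.
  - move=> i; rewrite -(splitK i); case: (fintype.split i) => {}i; rewrite /unsplit.
      rewrite koszul_degl cat_cochainl /single; case: eqP => // ->.
      by rewrite koszul_deg_top ltnn.
    by rewrite koszul_degr cat_cochainr => /g0.
  - move=> i; rewrite -(splitK i); case: (fintype.split i) => {}i; rewrite /unsplit.
      rewrite cobd_consl -[RHS](cobd_single u i).
      by apply: eq_bigr => j _; rewrite cat_cochainl.
    rewrite cobd_consr cat_cochainl.
    have -> : cobd (koszul_mx l) (fun j => cat_cochain (single u) g
       (rshift (koszul_rank l) j)) i = cobd (koszul_mx l) g i.
      by apply: eq_bigr => j _; rewrite cat_cochainr.
    by rewrite gE /single; case: eqP => _; rewrite ?scaler0 subrr.
  - move=> r g' /(_ (lshift _ (koszul_top l))).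
    rewrite cat_cochainl /single eqxx => ->.
    by rewrite cobd_consl; apply: cobd_top.
have [|c [c0 dc hc]] := IH; first by move=> y w yz; apply: hz; rewrite in_cons yz orbT.
exists (cat_cochain c (fun=> 0)); split.
- move=> i; rewrite -(splitK i); case: (fintype.split i) => {}i; rewrite /unsplit.
    by rewrite koszul_degl cat_cochainl; apply: c0.
  by rewrite cat_cochainr.
- move=> i; rewrite -(splitK i); case: (fintype.split i) => {}i; rewrite /unsplit.
    rewrite cobd_consl -[RHS](dc i).
    by apply: eq_bigr => j _; rewrite cat_cochainl.
  rewrite cobd_consr cat_cochainl hz ?mem_head // sub0r /cobd big1 ?oppr0 //.
  by move=> j _; rewrite cat_cochainr scaler0.
- move=> r g hrg; apply: (hc r (fun j => g (lshift _ j))) => i.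
  by have := hrg (lshift _ i); rewrite cat_cochainl cobd_consl.
Qed.

End Top.
End Koszul.

(** For a sequence [a :: l] of length [n] generating an ideal [I] such that [m] acts
    nilpotently on [M / I M], the product of [a_0(M), ..., a_(n-1)(M)] maps the colon
    [seq_mul l : a] into [seq_mul l]. *)
Lemma lc_annihilates_colon (R : comNzRingType) (m : set R) (M : lmodType R)
    (a : R) (l : seq R) (u : M) (r : nat -> R) :
  noetherian_ring R -> is_ideal m -> fin_gen [set: M] ->
  (forall b, m b -> exists t, forall w : M, seq_mul (a :: l) (b ^+ t *: w)) ->
  (forall k, (k < (size l).+1)%N -> ai m M k (r k)) ->
  seq_mul l (a *: u) -> seq_mul l ((\prod_(k < (size l).+1) r k) *: u).
Proof.
move=> noeth hm [s sE] hprim hr hu.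
have hann : is_ideal (ann_mod M).
  split; first by move=> w _; rewrite /= scale0r.
  move=> b c c' hc hc' w _; rewrite /= scalerDl -scalerA.
  by rewrite (hc w I) (hc' w I) scaler0 addr0.
have [zs zE] := noeth _ hann.
have zann z (w : M) : z \in zs -> z *: w = 0.
  move=> zz; suff : ann_mod M z by apply.
  by rewrite zE; apply: (@sub_span R R^o).
have [c [c0 dc hc]] := colon_cocycle zann hu.
have [Er] := injective_resolution_exists M.
have [|g gE] := @lc_annihilates R m M _ _ (@koszul_deg R (zs ++ a :: l)) noeth hm
    (koszul_mx_sq _) (@koszul_mx_deg _ _) _ Er (size l).+1 c r hr c0 dc; last exact: hc gE.
move=> b mb; have [t ht] := hprim b mb.
have hK : is_ideal (ideal_gen [set` a :: l]) by exact: ideal_gen_ideal.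
have [|p [T [Kp pann]]] := @cayley_hamilton_span R M _ s (b ^+ t) hK.
  by move=> w _; rewrite -sE; apply: ht.
have hL := ideal_gen_ideal [set` zs ++ a :: l].
exists (t * T)%N; apply: koszul_homotopy.
rewrite exprM -[_ ^+ T](subKr p); apply: (idealB hL).
  have : ann_mod M p by move=> w _; apply: pann; rewrite -sE.
  rewrite zE; apply: (@span_min R R^o _ _ hL) => z zz.
  by apply: sub_ideal_gen; rewrite /= mem_cat zz.
move: Kp; apply: ideal_gen_min => // z zz.
by apply: sub_ideal_gen; rewrite /= mem_cat (zz : z \in a :: l) orbT.
Qed.

(** * Annihilators of colons and intersections, formally *)

Section Telescoping.
Variables (R : comNzRingType) (M : lmodType R) (d : nat) (x : nat -> R).
Implicit Types (e f : nat -> nat).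

(** The submodule generated by the [x i ^+ e i *: w] with [i < d] and [0 < e i]: the
    exponent [0] means that [x i] is left out, not that the unit ideal is added. *)
Definition powM e : set M :=
  span [set u | exists i w, [/\ (i < d)%N, (0 < e i)%N & u = x i ^+ e i *: w]].

Lemma powM_submodule e : is_submodule (powM e).
Proof. exact: span_submodule. Qed.

Lemma mem_powM e i w : (i < d)%N -> (0 < e i)%N -> powM e (x i ^+ e i *: w).
Proof. by move=> id ei; apply: sub_span; exists i, w. Qed.

Lemma powM_min e (N : set M) : is_submodule N ->
  (forall i w, (i < d)%N -> (0 < e i)%N -> N (x i ^+ e i *: w)) -> powM e `<=` N.
Proof. by move=> hN h; apply: span_min => // _ [i [w [? ? ->]]]; apply: h. Qed.

Lemma powM_sub e f : (forall i, (0 < e i)%N -> f i = e i) -> powM e `<=` powM f.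
Proof.
move=> ef; apply: powM_min => [|i w id ei]; first exact: powM_submodule.
by rewrite -ef //; apply: mem_powM => //; rewrite ef.
Qed.

(** The exponents [e] with the one at [s] replaced by [k]. *)
Definition upd e s k : nat -> nat := fun i => if i == s then k else e i.

Lemma powM_upd e s k u : powM (upd e s k) u ->
  exists w y, powM e y /\ u = x s ^+ k *: w + y.
Proof.
have he := powM_submodule e.
suff : powM (upd e s k) `<=` [set u | exists w y, powM e y /\ u = x s ^+ k *: w + y].
  by apply.
apply: powM_min.
  split; first by exists 0, 0; rewrite scaler0 addr0; split=> //; exact: submod0.
  move=> c _ _ [w [y [hy ->]]] [w' [y' [hy' ->]]].
  exists (c *: w + w'), (c *: y + y'); split.
    by apply: (submodD he) => //; apply: (submodZ _ he).
  by rewrite !scalerDr scalerC addrACA.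
move=> i w id; rewrite /upd; case: eqP => [-> _|_ ei].
  by exists w, 0; rewrite addr0; split=> //; exact: submod0.
by exists 0, (x i ^+ e i *: w); rewrite scaler0 add0r; split=> //; apply: mem_powM.
Qed.

Lemma powM0 u : powM (fun=> 0%N) u -> u = 0.
Proof.
suff h : powM (fun=> 0%N) `<=` [set 0] by move=> /h.
by apply: powM_min => //; exact: set0_submodule.
Qed.

(** The ideal generated by the first [s] members of [x]. *)
Definition Qi s : set R := ideal_gen [set x i | i in `I_s].
(** The submodule [Q_s^n M]. *)
Definition Qn s n : set M := ideal_scale (ideal_pow (Qi s) n) [set: M].

Lemma Qn_submodule s n : is_submodule (Qn s n).
Proof. exact: ideal_scale_submodule. Qed.

Lemma Qn_decr s j n : (j <= n)%N -> Qn s n `<=` Qn s j.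
Proof. by move=> jn; apply: ideal_scaleS => //; apply: ideal_powS. Qed.

Lemma Qi_incr s : Qi s `<=` Qi s.+1.
Proof.
apply: ideal_gen_min; first exact: ideal_gen_ideal.
by move=> _ [i /= si <-]; apply: sub_ideal_gen; exists i => //=; rewrite ltnS ltnW.
Qed.

Lemma Qn_mul s n k u : Qn s n u -> Qn s.+1 (n + k) (x s ^+ k *: u).
Proof.
move=> hu; have {}hu : Qn s.+1 n u.
  by apply: ideal_scaleS hu => //; apply: ideal_pow_mono; exact: Qi_incr.
elim: k => [|k IH]; first by rewrite addn0 scale1r.
rewrite exprS -scalerA addnS /Qn /ideal_pow iterS -/(ideal_pow _ _) ideal_scale_mul.
by apply: mem_ideal_scale IH; apply: sub_ideal_gen; exists s => /=.
Qed.

Lemma Qn_powM s n e : (s <= d)%N -> (0 < n)%N ->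
  (forall i, (i < s)%N -> (0 < e i)%N) -> (\sum_(i < s) e i = s + n - 1)%N ->
  Qn s n `<=` powM e.
Proof.
move=> sd n0 e0 en.
have QE : Qi s = ideal_gen (range (fun i : 'I_s => x i)).
  congr (ideal_gen _); apply/seteqP; split=> a.
    by case=> i /= si <-; exists (Ordinal si).
  by case=> i _ <-; exists i => /=.
rewrite /Qn QE.
apply: subset_trans (@pow_pigeonhole R M s (fun i => x i) (fun i => (e i).-1) n _) _.
  suff : (\sum_(i < s) (e i).-1 + s = \sum_(i < s) e i)%N.
    by rewrite en; set S := (\sum_i _)%N; lia.
  rewrite -[X in (_ + X)%N = _]card_ord -sum1_card -big_split /=.
  by apply: eq_bigr => i _; rewrite addn1 prednK ?e0.
apply: span_min; first exact: powM_submodule.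
move=> _ [i [w ->]]; rewrite prednK ?e0 //.
by apply: mem_powM; rewrite ?e0 // (leq_trans (ltn_ord i)).
Qed.

Variable B : set R.
Hypothesis hB : is_ideal B.
Hypothesis colonB : forall e j k b u, (j < d)%N -> e j = 0%N -> (0 < k)%N ->
  B b -> powM e (x j ^+ k *: u) -> powM e (b *: u).

(** [al] agrees with [e] from [s] on, and its first [s] exponents form an element of
    Lambda_(s,n). *)
Definition extends s n e al :=
  [/\ forall i, (i < s)%N -> (0 < al i)%N, forall i, (s <= i)%N -> al i = e i
    & (\sum_(i < s) al i = s + n - 1)%N].

(** Part (2) for [s], modulo powers of parameters of index at least [s]. *)
Definition intersection_bound s := forall e n u r,
  (forall i, (i < s)%N -> e i = 0%N) -> (0 < n)%N ->
  (forall al, extends s n e al -> powM al u) ->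
  ideal_pow B (2 ^ (s - 1) - 1) r -> addS (Qn s n) (powM e) (r *: u).

(** Part (1) for [s], modulo powers of parameters of index at least [s]. *)
Definition colon_bound s := forall e n j k u r,
  (forall i, (i < s)%N -> e i = 0%N) -> (s <= j < d)%N -> e j = 0%N -> (0 < k)%N ->
  addS (Qn s n) (powM e) (x j ^+ k *: u) ->
  ideal_pow B (2 ^ (s - 1)) r -> addS (Qn s n) (powM e) (r *: u).

Lemma colon_of_intersection s : (s <= d)%N ->
  intersection_bound s -> colon_bound s.
Proof.
move=> sd hI e n j k u r e0 /andP[sj jd] ej k0 hu hr.
have hQ := addS_submodule (Qn_submodule s n) (powM_submodule e).
case: n hu hQ => [|n] hu hQ.
  by apply: addSl; [exact: powM_submodule|rewrite /Qn ideal_scaleT].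
have two : (2 ^ (s - 1) = (2 ^ (s - 1) - 1) + 1)%N by rewrite subnK // expn_gt0.
move: hr; rewrite two.
suff : ideal_pow B (2 ^ (s - 1) - 1 + 1) `<=`
    conductor (addS (Qn s n.+1) (powM e)) u by apply.
apply: ideal_pow_add_min; first exact: conductor_ideal.
move=> a b ha; rewrite ideal_pow1 // => hb; rewrite /conductor /= -scalerA.
apply: hI => // al [al0 ale aln].
apply: (colonB (j := j) (k := k)) => //; first by rewrite ale.
move: hu; apply: addS_min; first exact: powM_submodule.
  exact: Qn_powM.
apply: powM_sub => i ei; rewrite ale // leqNgt; apply/negP => si.
by rewrite e0 in ei.
Qed.

(** The elimination of the successive powers of [x s]. *)
Lemma telescope s n e v r : (s < d)%N -> (0 < n)%N -> colon_bound s ->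
  (forall i, (i < s.+1)%N -> e i = 0%N) ->
  (forall k, (0 < k <= n)%N -> addS (Qn s (n + 1 - k)) (powM (upd e s k)) v) ->
  ideal_pow B (2 ^ (s - 1)) r -> addS (Qn s.+1 n) (powM e) (r *: v).
Proof.
move=> sd n0 hC e0 hv hr.
have he := powM_submodule e.
have hQ j : is_submodule (addS (Qn s j) (powM e)).
  by apply: addS_submodule => //; exact: Qn_submodule.
have hQ1 : is_submodule (addS (Qn s.+1 n) (powM e)).
  by apply: addS_submodule => //; exact: Qn_submodule.
have mulQ j k w : addS (Qn s j) (powM e) w -> (j + k)%N = n ->
    addS (Qn s.+1 n) (powM e) (x s ^+ k *: w).
  move=> [q [y [hq hy ->]]] jk; rewrite scalerDr.
  exists (x s ^+ k *: q), (x s ^+ k *: y); split=> //; last exact: (submodZ _ he).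
  by rewrite -jk; apply: Qn_mul.
have decr j j' : (j <= j')%N -> addS (Qn s j') (powM e) `<=` addS (Qn s j) (powM e).
  move=> jj'; apply: (addS_min (hQ j)); last by apply: addSr; exact: Qn_submodule.
  by move=> q hq; apply: addSl => //; apply: Qn_decr hq.
(* q collects the terms treated so far; the remaining one is divisible by a power
   of x s *)
have tele k : (k < n)%N -> exists q w y,
    [/\ addS (Qn s (n - k)) (powM e) q, addS (Qn s.+1 n) (powM e) (r *: q),
        powM e y & v = q + x s ^+ k.+1 *: w + y].
  elim: k => [|k IH] kn.
    have [|q [y [hq /powM_upd[w [y' [hy' ->]]] ->]]] := hv 1%N; first by rewrite n0.
    rewrite addnK in hq.
    exists q, w, y'; rewrite subn0 addrA; split=> //; first exact: addSl.
    rewrite -[_ *: _]scale1r; apply: (mulQ n 0%N); last by rewrite addn0.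
    by apply: (submodZ _ (hQ _)); apply: addSl.
  have [q [w [y [hq hrq hy vE]]]] := IH (ltnW kn).
  have [|q' [y0 [hq' /powM_upd[w' [y' [hy' ->]]] vE']]] := hv k.+2; first by [].
  have nk : (n + 1 - k.+2 = n - k.+1)%N by lia.
  rewrite nk in hq'.
  pose t := w - x s *: w'.
  have tE : x s ^+ k.+1 *: t = (q' + y') - (q + y).
    rewrite /t scalerBr scalerA -exprSr.
    have -> : x s ^+ k.+1 *: w = v - (q + y).
      by rewrite vE [q + _ + y]addrAC [q + y + _]addrC addrK.
    have -> : x s ^+ k.+2 *: w' = v - (q' + y').
      by rewrite vE' [q' + _]addrCA addrK.
    by rewrite opprB addrC addrA subrK.
  have hq'y' : addS (Qn s (n - k.+1)) (powM e) (q' + y') by exists q', y'.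
  have hqy : addS (Qn s (n - k.+1)) (powM e) (q + y).
    apply: (submodD (hQ _)); last by apply: addSr => //; exact: Qn_submodule.
    by apply: decr hq; rewrite leq_sub2l.
  have hXt := submodB (hQ _) hq'y' hqy; rewrite -tE in hXt.
  have hrt : addS (Qn s (n - k.+1)) (powM e) (r *: t).
    apply: hC hXt hr => //; last exact: e0.
      by move=> i si; apply: e0; rewrite ltnW.
    by rewrite leqnn.
  exists (q + x s ^+ k.+1 *: t), w', y; split=> //.
  - apply: (submodD (hQ _)) => //; apply: decr hq; rewrite leq_sub2l //.
  - rewrite scalerDr scalerC; apply: (submodD hQ1) => //.
    by apply: (mulQ _ _ _ hrt); lia.
  - by rewrite /t scalerBr scalerA -exprSr addrA subrK.
have [q [w [y [_ hrq hy ->]]]] := tele n.-1 ltac:(by rewrite prednK).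
rewrite prednK // !scalerDr scalerC; apply: (submodD hQ1).
  apply: (submodD hQ1) => //; apply: (mulQ 0%N n) => //.
  by apply: addSl => //; rewrite /Qn ideal_scaleT.
by apply: addSr; [exact: Qn_submodule|exact: (submodZ _ he)].
Qed.

Lemma intersection_step s : (0 < s)%N -> (s < d)%N ->
  intersection_bound s -> intersection_bound s.+1.
Proof.
move=> s0 sd hI e n u r e0 n0 hu.
have hC := colon_of_intersection (ltnW sd) hI.
have hQ1 : is_submodule (addS (Qn s.+1 n) (powM e)).
  by apply: addS_submodule; [exact: Qn_submodule|exact: powM_submodule].
have pE : (2 ^ (s.+1 - 1) - 1 = 2 ^ (s - 1) + (2 ^ (s - 1) - 1))%N.
  have : (0 < 2 ^ (s - 1))%N by rewrite expn_gt0.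
  have -> : (s.+1 - 1 = (s - 1).+1)%N by lia.
  by rewrite expnS; lia.
rewrite pE; set p1 := (2 ^ (s - 1))%N; set p2 := (p1 - 1)%N.
suff : ideal_pow B (p1 + p2) `<=` conductor (addS (Qn s.+1 n) (powM e)) u by apply.
apply: ideal_pow_add_min; first exact: conductor_ideal.
move=> r2 r1 hr2 hr1; rewrite /conductor /= -scalerA.
apply: telescope hr2 => // k /andP[k0 kn].
apply: hI hr1; first by move=> i si; rewrite /upd ltn_eqF // e0 // ltnW.
  by lia.
move=> al [al0 ale aln]; apply: hu; split.
- move=> i; rewrite ltnS leq_eqVlt => /orP[/eqP ->|/al0 //].
  by rewrite ale // /upd eqxx.
- by move=> i si; rewrite (ale i (ltnW si)) /upd (gtn_eqF si).
- by rewrite big_ord_recr /= aln ale // /upd eqxx; lia.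
Qed.

Lemma intersection_bound1 : intersection_bound 1.
Proof.
move=> e n u r e0 n0 hu _.
have hQ : is_submodule (addS (Qn 1 n) (powM e)).
  by apply: addS_submodule; [exact: Qn_submodule|exact: powM_submodule].
apply: (submodZ _ hQ).
have [|w [y [hy ->]]] := @powM_upd e 0%N n u.
  apply: hu; split.
  - by case.
  - by case.
  - by rewrite big_ord1 /upd /=; lia.
apply: (submodD hQ); last by apply: addSr => //; exact: Qn_submodule.
apply: addSl; first exact: powM_submodule.
by apply: (@Qn_mul 0 0 n); rewrite /Qn ideal_scaleT.
Qed.

Lemma intersection_boundP s : (0 < s <= d)%N -> intersection_bound s.
Proof.
case: s => // s; elim: s => [|s IH] /andP[_ sd]; first exact: intersection_bound1.
by apply: intersection_step => //; apply: IH; rewrite /= ltnW.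
Qed.

Lemma colon_boundP s : (0 < s <= d)%N -> colon_bound s.
Proof.
by move=> hs; apply: colon_of_intersection; [case/andP: hs|apply: intersection_boundP].
Qed.

End Telescoping.

Arguments Qn {R} M x s n.

(** * Systems of parameters *)

Section SystemsOfParameters.
Variables (R : comNzRingType) (m : set R) (M : lmodType R) (d : nat).
Hypotheses (noeth : noetherian_ring R) (hlocal : local_ring m)
  (Mfg : fin_gen [set: M]).
Implicit Types (x : d.-tuple R).

Lemma QsE x s : (s <= d)%N -> Qs x s = Qi (fun i => x`_i) s.
Proof.
move=> sd; congr (ideal_gen _); apply/seteqP; split=> a.
  by case=> i _ <-; exists i => /=.
by case=> i /= si <-; exists (Ordinal si).
Qed.

(** If a power of [a] maps [M] into [(x) M], and powers of the [x i] map [M] into [N],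
    then a power of [a] maps [M] into [N]. *)
Lemma power_into_submodule n (x : 'I_n -> R) (e : 'I_n -> nat) (N : set M) a t :
  is_submodule N ->
  (forall u, ideal_scale (ideal_gen (range x)) [set: M] (a ^+ t *: u)) ->
  (forall i w, N (x i ^+ (e i).+1 *: w)) ->
  exists t', forall u, N (a ^+ t' *: u).
Proof.
move=> hN ha hxN; set Q := ideal_gen (range x) in ha *.
have haK K u : ideal_scale (ideal_pow Q K) [set: M] (a ^+ (t * K) *: u).
  elim: K u => [|K IH] u; first by rewrite ideal_scaleT.
  have hK := ideal_scale_submodule (ideal_pow Q K.+1) [set: M].
  rewrite mulnS exprD -scalerA.
  have := IH u; set v := _ *: u; move: v => v {u}.
  suff : ideal_scale (ideal_pow Q K) [set: M] `<=`
      colon (ideal_scale (ideal_pow Q K.+1) [set: M]) (a ^+ t) by apply.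
  apply: ideal_scale_min; first exact: colon_submodule.
  move=> c w hc _.
  change (ideal_scale (ideal_pow Q K.+1) [set: M] (a ^+ t *: (c *: w))).
  rewrite scalerC.
  rewrite ideal_scale_pow; last exact: setT_submodule.
  rewrite iterSr -ideal_scale_pow; last exact: ideal_scale_submodule.
  exact: mem_ideal_scale.
exists (t * (\sum_i e i).+1)%N => u; have := haK (\sum_i e i).+1 u.
suff : ideal_scale (ideal_pow Q (\sum_i e i).+1) [set: M] `<=` N by apply.
apply: subset_trans (@pow_pigeonhole R M n x e _ (ltnSn _)) _.
by apply: span_min => // _ [i [w ->]].
Qed.

(** A system of parameters consists of elements of [m] such that each element of [m]
    acts nilpotently on [M / (x) M]. *)
Lemma sopP x : sop m M x <-> (forall i : 'I_d, m x`_i) /\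
  forall a, m a -> exists t, forall u : M,
    ideal_scale (Qs x d) [set: M] (a ^+ t *: u).
Proof.
have hN := ideal_scale_submodule (Qs x d) [set: M].
have hP := finite_colengthP hlocal Mfg noeth hN.
by split=> -[hx h]; split=> //; apply/hP.
Qed.

(** A [d]-tuple of elements of [m] is a system of parameters as soon as a positive
    power of every member of some system of parameters occurs in it. *)
Lemma sop_powers x (y : d.-tuple R) (e : 'I_d -> nat) :
  sop m M x -> (forall i : 'I_d, m y`_i) ->
  (forall i : 'I_d, x`_i ^+ (e i).+1 \in (y : seq R)) -> sop m M y.
Proof.
move=> /sopP[hx hxp] hy hxy; apply/sopP; split=> // a ma.
have [t ht] := hxp a ma.
apply: (@power_into_submodule d (fun i : 'I_d => x`_i) e _ a t) => //.
  exact: ideal_scale_submodule.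
move=> i w; apply: mem_ideal_scale => //; apply: sub_ideal_gen.
have /(nthP 0)[j jd <-] := hxy i; rewrite size_tuple in jd.
by exists (Ordinal jd).
Qed.

(** The permuted sequence puts the powers with nonzero exponent first, then [x_j ^+ k],
    then the remaining parameters. *)
Lemma bM_colon x (e : nat -> nat) j k b (u : M) :
  sop m M x -> (j < d)%N -> e j = 0%N -> (0 < k)%N -> bM m M d b ->
  powM d (fun i => x`_i) e (x`_j ^+ k *: u) ->
  powM d (fun i => x`_i) e (b *: u).
Proof.
move=> hx jd ej k0 hb hu.
pose T := [seq i <- iota 0 d | 0 < e i]%N.
pose O := [seq i <- iota 0 d | (e i == 0%N) && (i != j)].
(* the reordered parameters, with the powers required by e and k *)
pose yl := [seq x`_i ^+ e i | i <- T] ++ x`_j ^+ k :: [seq x`_i | i <- O].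
have ysz : size yl == d.
  apply/eqP; rewrite size_cat /= !size_map !size_filter -[RHS](size_iota 0 d).
  rewrite -(count_predC (fun i => 0 < e i)%N (iota 0 d)); congr (_ + _)%N.
  pose P i := (e i == 0%N) && (i != j).
  have := count_predUI (pred1 j) P (iota 0 d).
  rewrite count_uniq_mem ?iota_uniq // mem_iota leq0n add0n jd.
  rewrite [X in (_ + X)%N](@eq_count _ _ pred0) ?count_pred0 ?addn0; last first.
    by move=> i; rewrite /= /P; case: (i == j); rewrite ?andbF.
  rewrite add1n => <-; apply: eq_count => i; rewrite /= /P -eqn0Ngt.
  by case: eqVneq => [->|]; rewrite ?ej ?eqxx ?andbT.
pose y : d.-tuple R := Tuple ysz.
have mx i : (i < d)%N -> m x`_i.
  by move=> id; case: hx => /(_ (Ordinal id)).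
have hm := local_ideal hlocal.
have mX i n : (i < d)%N -> (0 < n)%N -> m (x`_i ^+ n).
  by move=> /mx mi; case: n => // n _; rewrite exprS; apply: idealMr.
have Td i : i \in T -> (i < d)%N /\ (0 < e i)%N.
  by rewrite mem_filter mem_iota add0n => /andP[-> /andP[_ ->]].
have ym i : i \in yl -> m i.
  rewrite mem_cat in_cons => /orP[/mapP[l /Td[ld el] ->]|/orP[/eqP ->|/mapP[l + ->]]].
  - exact: mX.
  - exact: mX.
  - by rewrite mem_filter mem_iota add0n => /andP[_ /andP[_]]; apply: mx.
have hy : sop m M y.
  apply: (@sop_powers x y
    (fun i => (if (i : nat) == j then k else if (0 < e i)%N then e i else 1%N).-1)) => //.
    by move=> i; apply/ym/mem_nth; rewrite (eqP ysz).
  move=> i; rewrite mem_cat in_cons.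
  have [->|ij] := eqVneq (i : nat) j; first by rewrite prednK // eqxx orbT.
  have [ei|ei] := ltnP 0 (e i).
    rewrite prednK //; apply/orP; left; apply/mapP; exists (i : nat) => //.
    by rewrite mem_filter ei mem_iota add0n leq0n ltn_ord.
  apply/orP; right; apply/orP; right; apply/mapP; exists (i : nat) => //.
  rewrite mem_filter mem_iota add0n leq0n ltn_ord ij andbT.
  by move: ei; rewrite leqn0 => ->.
have sT : (size T < d)%N.
  by rewrite -(eqP ysz) size_cat size_map /= addnS ltnS leq_addr.
have yT : y`_(size T) = x`_j ^+ k.
  by rewrite /= /yl nth_cat size_map ltnn subnn.
have QE : ideal_scale (Qs y (size T)) [set: M] = powM d (fun i => x`_i) e.
  rewrite ideal_scale_gen; last exact: setT_submodule.
  congr (span _); apply/seteqP; split=> v.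
    case=> _ [i _ <-] [w _ <-].
    have iT : nth 0%N T i \in T by apply: mem_nth.
    have [? ?] := Td _ iT; exists (nth 0%N T i), w; split=> //.
    by rewrite /= nth_cat size_map ltn_ord (nth_map 0%N).
  case=> i [w [id ei ->]].
  have iT : i \in T by rewrite mem_filter ei mem_iota add0n leq0n id.
  exists (x`_i ^+ e i); last by exists w.
  have it : (index i T < size T)%N by rewrite index_mem.
  exists (Ordinal it) => //=.
  by rewrite nth_cat size_map it (nth_map 0%N) // nth_index.
have := hb _ sT y hy; rewrite QE yT.
by apply.
Qed.

(** The members of [x] after the one at [s] are replaced by high powers, which [m^N]
    absorbs. *)
Lemma aM_sub_bM : aM m M d `<=` bM m M d.
Proof.
move=> r hr s /= sd x hx u hu.
have hm := local_ideal hlocal.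
have hQ := ideal_scale_submodule (Qs x s) [set: M].
apply: (krull_intersection hlocal Mfg noeth hQ) => N.
pose l := [seq x`_i | i <- iota 0 s] ++ [seq x`_i ^+ N.+1 | i <- iota s.+1 (d - s.+1)].
have lsz : (size l).+1 = d by rewrite size_cat !size_map !size_iota; lia.
have hl := @seq_mul_submodule R M l.
have Ql : ideal_scale (Qs x s) [set: M] `<=` seq_mul l.
  apply: ideal_scaleS => //; apply: ideal_gen_min; first exact: ideal_gen_ideal.
  move=> _ [i _ <-]; apply: sub_ideal_gen; rewrite /= mem_cat; apply/orP; left.
  by apply/mapP; exists (i : nat); rewrite // mem_iota add0n leq0n ltn_ord.
have mx i : (i < d)%N -> m x`_i.
  by move=> id; case: hx => /(_ (Ordinal id)).
have lQ : seq_mul l `<=` addS (ideal_scale (Qs x s) [set: M])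
    (ideal_scale (ideal_pow m N) [set: M]).
  have hmN := ideal_scale_submodule (ideal_pow m N) [set: M].
  apply: seq_mul_min; first exact: addS_submodule.
  move=> a w; rewrite mem_cat => /orP[/mapP[i]|/mapP[i]]; rewrite mem_iota.
    rewrite add0n => /andP[_ si] ->; apply: addSl => //.
    by apply: mem_ideal_scale => //; apply: sub_ideal_gen; exists (Ordinal si).
  move=> /andP[si id] ->; apply: addSr => //; apply: mem_ideal_scale => //.
  apply: (@ideal_powS R m N N.+1) => //; apply: mem_ideal_pow; apply: mx; lia.
apply: lQ.
have hprim b : m b -> exists t, forall w : M, seq_mul (x`_s :: l) (b ^+ t *: w).
  move=> mb; have [_ /(_ b mb)[t ht]] := proj1 (sopP x) hx.
  apply: (@power_into_submodule d (fun i : 'I_d => x`_i)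
    (fun i : 'I_d => if (i <= s)%N then 0%N else N) _ b t) => //.
    exact: seq_mul_submodule.
  move=> i w; apply: mem_seq_mul; have id := ltn_ord i.
  rewrite in_cons mem_cat; case: (ltngtP i s) => [si|si|->].
  - rewrite expr1; apply/orP; right; apply/orP; left; apply/mapP.
    by exists (i : nat); rewrite // mem_iota add0n.
  - apply/orP; right; apply/orP; right; apply/mapP.
    by exists (i : nat); rewrite // mem_iota si /=; lia.
  - by rewrite expr1 eqxx.
suff : conductor (seq_mul l) u (1 * r) by rewrite mul1r.
apply: (@big_ideal_mul_min R d (fun i => ai m M i) (conductor (seq_mul l) u) 1 _ _ r hr).
  exact: conductor_ideal.
move=> rr hrr; rewrite mul1r /conductor /=.
pose rn k := if insub k is Some i then rr i else 0.
have -> : \prod_i rr i = \prod_(k < (size l).+1) rn k.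
  by rewrite lsz; apply: eq_bigr => i _; rewrite /rn valK.
apply: (lc_annihilates_colon noeth hm Mfg hprim); last exact: Ql _ hu.
by move=> k; rewrite lsz => kd; rewrite /rn insubT; apply: (hrr (Ordinal kd)).
Qed.

Lemma bM_ideal : is_ideal (bM m M d).
Proof.
split.
  move=> s _ x _ u _; rewrite /= scale0r; apply: submod0; exact: ideal_scale_submodule.
move=> a b c hb hc s sd x hx u hu; rewrite /= scalerDl -scalerA.
have hQ := ideal_scale_submodule (Qs x s) [set: M].
by apply: (submodD hQ); [apply: (submodZ _ hQ); apply: hb|apply: hc].
Qed.

Lemma QsnME x s n : (s <= d)%N -> QsnM M x s n = Qn M (fun i => x`_i) s n.
Proof. by move=> sd; rewrite /QsnM QsE. Qed.

Lemma addS_powM0 x s n : addS (Qn M (fun i => x`_i) s n)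
  (powM d (fun i => x`_i) (fun=> 0%N)) `<=` Qn M (fun i => x`_i) s n.
Proof. by move=> _ [q [y [hq /powM0 -> ->]]]; rewrite addr0. Qed.

Lemma bM_sub_cs s : (0 < s)%N -> (s < d)%N ->
  ideal_pow (bM m M d) (2 ^ (s - 1)) `<=` cs m M d s.
Proof.
move=> s0 sd r hr x hx n /= n0 u; rewrite /colon /= QsnME 1?ltnW // => hu.
apply: addS_powM0.
have hc e j k b v := @bM_colon x e j k b v hx.
have sd' : (0 < s <= d)%N by rewrite s0 ltnW.
apply: (colon_boundP bM_ideal hc sd' (j := s) (k := 1%N)) hr => //.
  by rewrite leqnn.
by apply: addSl => //; exact: powM_submodule.
Qed.

Lemma bM_sub_ds s : (0 < s <= d)%N ->
  ideal_pow (bM m M d) (2 ^ (s - 1) - 1) `<=` ds m M d s.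
Proof.
move=> sd r hr x hx n /= n0 u hu; have /andP[_ sd'] := sd.
rewrite QsnME //; apply: addS_powM0.
have hc e j k b v := @bM_colon x e j k b v hx.
apply: (intersection_boundP bM_ideal hc sd) hr => // al [al0 ale aln].
have : ideal_scale (Qs_alpha x (fun i : 'I_s => al i)) [set: M] u.
  by apply: hu; split=> // i; apply: al0.
rewrite /Qs_alpha ideal_scale_gen; last exact: setT_submodule.
apply: span_min; first exact: powM_submodule.
move=> _ [_ [i _ <-] [w _ <-]]; apply: mem_powM; last exact: al0.
exact: leq_trans (ltn_ord i) _.
Qed.

Lemma bM_sub_cs0 : (0 < d)%N -> bM m M d `<=` cs m M d 0%N.
Proof.
move=> d0 b hb x hx n /= n0 u.
have Q0 (v : M) : QsnM M x 0 n v -> v = 0.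
  case: n n0 => // n _.
  rewrite /QsnM /ideal_pow iterS ideal_scale_mul ideal_scale_gen; last first.
    exact: ideal_scale_submodule.
  have h0 := set0_submodule M.
  suff : span [set a *: w | a in range (fun i : 'I_0 => x`_i) & w in
     ideal_scale (iter n (ideal_mul (Qs x 0)) setT) [set: M]] `<=` [set 0] by move=> h /h.
  by apply: span_min => // ? [? [[]]].
move=> /Q0 hu.
have hbs := hb 0%N d0 x hx u.
have -> : b *: u = 0.
  have := hbs _; rewrite /colon /= hu => /(_ (submod0 (ideal_scale_submodule _ _))).
  rewrite ideal_scale_gen; last exact: setT_submodule.
  have h0 := set0_submodule M.
  suff : span [set a *: w | a in range (fun i : 'I_0 => x`_i) & w in [set: M]]
    `<=` [set 0] by move=> h /h.
  by apply: span_min => // ? [? [[]]].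
by apply: submod0; exact: ideal_scale_submodule.
Qed.

End SystemsOfParameters.

Theorem theorem4p2 (R : comNzRingType) (m : set R) (M : lmodType R) (d : nat)
    (hnoeth : noetherian_ring R) (hlocal : local_ring m)
    (hfg : fin_gen [set: M]) (hdim : module_dim M d) (hd : (0 < d)%N) :
  [/\ (forall s : nat, (1 <= s <= d - 1)%N ->
         ideal_pow (bM m M d) (2 ^ (s - 1))%N `<=` cs m M d s)
      /\ bM m M d `<=` cs m M d 0%N,
      forall s : nat, (1 <= s <= d)%N ->
         ideal_pow (bM m M d) (2 ^ (s - 1) - 1)%N `<=` ds m M d s,
      forall (x : d.-tuple R) (n s : nat), sop m M x -> (1 <= n)%N ->
         (1 <= s <= d - 1)%N ->
         ideal_scale (ideal_pow (aM m M d) (2 ^ (d - 2))%N)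
                     (colon (QsnM M x s n) x`_s)
           `<=` QsnM M x s n
    & forall (x : d.-tuple R) (n s : nat), sop m M x -> (1 <= n)%N ->
         (1 <= s <= d)%N ->
         ideal_scale (ideal_pow (aM m M d) (2 ^ (d - 1))%N)
                     (bigcap_QalphaM M x s n)
           `<=` QsnM M x s n].
Proof.
have ab := aM_sub_bM (d := d) hnoeth hlocal hfg.
split.
- split; last exact: bM_sub_cs0.
  move=> s /andP[s0 sd]; apply: bM_sub_cs => //; lia.
- by move=> s hs; apply: bM_sub_ds.
- move=> x n s hx n0 /andP[s0 sd].
  apply: ideal_scale_min; first exact: ideal_scale_submodule.
  move=> a u ha hu.
  have sd' : (s < d)%N by lia.
  apply: (bM_sub_cs hnoeth hlocal hfg s0 sd' _ hx n0 hu).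
  apply: (@ideal_powS R _ (2 ^ (s - 1)) (2 ^ (d - 2))); first by rewrite leq_pexp2l //; lia.
  by apply: ideal_pow_mono ha.
- move=> x n s hx n0 hs.
  apply: ideal_scale_min; first exact: ideal_scale_submodule.
  move=> a u ha hu.
  apply: (bM_sub_ds hnoeth hlocal hfg hs _ hx n0 hu).
  apply: (@ideal_powS R _ (2 ^ (s - 1) - 1) (2 ^ (d - 1))).
    by apply: leq_trans (leq_subr _ _) _; rewrite leq_pexp2l //; lia.
  by apply: ideal_pow_mono ha.
Qed.
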